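(* There is an absolute constant $C>0$ such that the following holds. Let $p$ be a positive integer, let $\mathbb{F}$ be a finite field of order $c$, and let $\sigma$ be a sesqui-morphism on $\mathbb{F}$. If $G$ is a pivot-minor obstruction for $\sigma$-symmetric $\mathbb{F}^*$-graphs of linear rank-width at most $p$, then $|V_G|\le c^{c^{Cp}}$ (that is, $|V_G|$ is bounded by $c^{c^{O(p)}}$).
   Context: A sesqui-morphism on a field $\mathbb{F}$ is a bijection $\sigma:\mathbb{F}\to\mathbb{F}$ with $\sigma(\sigma(a))=a$ for all $a$ such that $a\mapsto \sigma(a)/\sigma(1)$ is a field automorphism of $\mathbb{F}$. An $\mathbb{F}^*$-graph $G$ is a finite loopless graph with vertex set $V_G$ together with an adjacency $(V_G,V_G)$-matrix $M_G$ over $\mathbb{F}$ with $M_G[x,x]=0$ and $M_G[x,y]\neq 0$ iff $xy$ is an edge ($M_G$ need not be symmetric). $G$ is $\sigma$-symmetric if $M_G[x,y]=\sigma(M_G[y,x])$ for all $x,y$. For $x,y$ with $M_G[x,y]\neq0$, the pivot complementation $G\wedge xy$ is the $\mathbb{F}^*$-graph on $V_G$ with $M'=M_{G\wedge xy}$ given by $M'[z,z]=0$; for distinct $s,t\in V_G\setminus\{x,y\}$: $M'[s,t]=M_G[s,t]-\frac{M_G[s,x]M_G[y,t]}{M_G[y,x]}-\frac{M_G[s,y]M_G[x,t]}{M_G[x,y]}$; for $t,s\in V_G\setminus\{x,y\}$: $M'[x,t]=\frac{M_G[y,t]}{M_G[y,x]}$, $M'[y,t]=\frac{\sigma(1)M_G[x,t]}{M_G[x,y]}$,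 $M'[s,x]=\frac{\sigma(1)M_G[s,y]}{M_G[x,y]}$, $M'[s,y]=\frac{M_G[s,x]}{M_G[y,x]}$; and $M'[x,y]=-\frac{1}{M_G[y,x]}$, $M'[y,x]=-\frac{\sigma(1)^2}{M_G[x,y]}$. A graph is pivot equivalent to $G$ if it is obtained from $G$ by a sequence of pivot complementations. For $X\subseteq V_G$, $G[X]$ is the $\mathbb{F}^*$-graph on $X$ with matrix $M_G[X]$. Two $\mathbb{F}^*$-graphs $G,H$ are simply isomorphic if there is a bijection $h:V_G\to V_H$ with $M_G[x,y]=M_H[h(x),h(y)]$ for all $x,y$. $H$ is a pivot-minor of $G$ if $H$ is simply isomorphic to an induced subgraph of a graph pivot equivalent to $G$; it is proper if $|V_H|<|V_G|$. The cut-rank is $\mathrm{cutrk}_G(X)=\mathrm{rank}_{\mathbb{F}}(M_G[X,V_G\setminus X])$ (defined as $0$ if $X$ or $V_G\setminus X$ is empty). A linear layout of $G$ with $n=|V_G|$ is a bijection $\pi:V_G\to[n]$; its width is $\max_{1\le i\le n-1}\mathrm{cutrk}_G(\pi^{-1}([i]))$; the linear rank-width $\mathrm{lrw}(G)$ is the minimum width of a linear layout. A pivot-minor obstruction for $\sigma$-symmetric $\mathbb{F}^*$-graphs of linear rank-width at most $p$ is a $\sigma$-symmetric $\mathbb{F}^*$-graph $G$ with $\mathrm{lrw}(G)>p$ such that every proper pivot-minor of $G$ has linear rank-width at most $p$. *)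

(* Defs.v *)
From mathcomp Require Import all_boot all_algebra.
Set Implicit Arguments.
Unset Strict Implicit.
Unset Printing Implicit Defensive.
Import GRing.Theory.
Local Open Scope ring_scope.

(* As 0 / 0 = 0, the last clause evaluated at 1 forces sigma 1 != 0. *)
Definition sesqui_morphism (F : fieldType) (sigma : F -> F) : Prop :=
  [/\ bijective sigma, involutive sigma
    & exists f : {rmorphism F -> F},
        bijective f /\ forall a, f a = sigma a / sigma 1].

(* An F^*-graph with vertex set V: x y is an edge iff adj x y != 0, so the
   matrix determines the graph. *)
Record star_graph (F : fieldType) (V : finType) := StarGraph {
  adj :> V -> V -> F;
  adj_loopless : forall x, adj x x = 0
}.

Section StarGraphs.
Variable F : fieldType.
Implicit Types V W : finType.

Definition sigma_symmetric (sigma : F -> F) V (G : star_graph F V) : Prop :=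
  forall x y, G x y = sigma (G y x).

Section Pivot.
Variables (sigma : F -> F) (V : finType).

Definition pivot_adj (G : star_graph F V) (x y s t : V) : F :=
  if s == t then 0
  else if s == x then
    if t == y then - (1 / G y x) else G y t / G y x
  else if s == y then
    if t == x then - (sigma 1 ^+ 2 / G x y) else sigma 1 * G x t / G x y
  else if t == x then sigma 1 * G s y / G x y
  else if t == y then G s x / G y x
  else G s t - G s x * G y t / G y x - G s y * G x t / G x y.

Lemma pivot_loopless (G : star_graph F V) (x y z : V) : pivot_adj G x y z z = 0.
Proof. by rewrite /pivot_adj eqxx. Qed.

Definition pivot (G : star_graph F V) (x y : V) : star_graph F V :=
  StarGraph (pivot_loopless G x y).

Inductive pivot_equivalent (G : star_graph F V) : star_graph F V -> Prop :=
| pivot_equivalent_refl : pivot_equivalent G G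
| pivot_equivalent_step (G' : star_graph F V) (x y : V) :
    pivot_equivalent G G' -> G' x y != 0 ->
    pivot_equivalent G (pivot G' x y).

End Pivot.

Section Induced.
Variables (V : finType) (G : star_graph F V) (X : {set V}).

Lemma induced_loopless (x : {x : V | x \in X}) : G (val x) (val x) = 0.
Proof. exact: adj_loopless. Qed.

Definition induced : star_graph F {x : V | x \in X} :=
  @StarGraph F {x : V | x \in X} (fun x y => G (val x) (val y)) induced_loopless.

End Induced.

Definition simply_isomorphic V W (G : star_graph F V) (H : star_graph F W) : Prop :=
  exists h : V -> W, bijective h /\ forall x y, G x y = H (h x) (h y).

Definition pivot_minor (sigma : F -> F) V W
    (H : star_graph F W) (G : star_graph F V) : Prop :=
  exists G' : star_graph F V, pivot_equivalent sigma G G' /\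
  exists X : {set V}, simply_isomorphic H (induced G' X).

Definition proper_pivot_minor (sigma : F -> F) V W
    (H : star_graph F W) (G : star_graph F V) : Prop :=
  pivot_minor sigma H G /\ (#|W| < #|V|)%N.

Definition cutrk V (G : star_graph F V) (X : {set V}) : nat :=
  \rank (\matrix_(i < #|X|, j < #|~: X|) G (enum_val i) (enum_val j)).

Definition linear_layout V (pi : {ffun V -> 'I_#|V|}) : bool := injectiveb pi.

Lemma linear_layoutP V (pi : {ffun V -> 'I_#|V|}) :
  reflect (bijective pi) (linear_layout pi).
Proof.
apply: (iffP (injectiveP _)) => [pi_inj|/bij_inj//].
by apply: inj_card_bij; rewrite ?card_ord.
Qed.

(* Positions start at 0, so the inverse image of the first i positions is
   [set x | pi x < i]. *)
Definition layout_width V (G : star_graph F V) (pi : {ffun V -> 'I_#|V|}) : nat :=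
  \max_(1 <= i < #|V|) cutrk G [set x | (pi x < i)%N].

Definition enum_layout V : {ffun V -> 'I_#|V|} := [ffun x => enum_rank x].

Lemma enum_layoutP V : linear_layout (enum_layout V).
Proof. by apply/injectiveP => x y; rewrite !ffunE => /enum_rank_inj. Qed.

Definition lrw V (G : star_graph F V) : nat :=
  layout_width G [arg min_(pi < enum_layout V | linear_layout pi)
                    layout_width G pi].

Lemma lrw_leP V (G : star_graph F V) (k : nat) :
  (lrw G <= k)%N <->
  exists pi : {ffun V -> 'I_#|V|}, bijective pi /\ (layout_width G pi <= k)%N.
Proof.
rewrite /lrw; case: arg_minnP => [|pi /linear_layoutP pi_bij pi_min].
  exact: enum_layoutP.
split=> [?|[rho [/linear_layoutP/pi_min]]]; first by exists pi.
exact: leq_trans.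
Qed.

Definition pivot_minor_obstruction (sigma : F -> F) (p : nat) V
    (G : star_graph F V) : Prop :=
  [/\ sigma_symmetric sigma G, (p < lrw G)%N
    & forall W (H : star_graph F W),
        proper_pivot_minor sigma H G -> (lrw H <= p)%N].

End StarGraphs.

(* Main.v *)
Require Import Defs.
From mathcomp Require Import all_boot all_algebra.
From mathcomp Require Import ring zify.

(**
Fix G with adjacency matrix M and identify a row vector u with the pair
(u, uM).  The cut-rank of X is #|X| minus the dimension of the cut space of X,
the vectors u such that u and uM both vanish outside X.  A pivot only exchanges
u and uM at two vertices, and otherwise changes uM at a vertex by a multiple of
u there, so the pairs vanishing at a given vertex are the same before and after.

A layout of G of width at most p+1 contains a long strictly increasing chain of
sets A_i of the same cut-rank r, with no smaller cut-rank in between.  By a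
Tutte-type linking theorem the vertices of A_(i+1) \ A_i can be removed by
pivots and deletions so that A_i still has cut-rank r in the resulting graph H_i
on A_i and the complement of A_(i+1).  The boundary space of dimension 2r of A_i
is then identified with that of A_(i+1), through a map theta, and cut-ranks of
G and of H_i are both obtained by gluing the same two sides along it.

How the side outside A_i meets the steps of a layout is recorded by a sequence
of pairs (subspace of the boundary, number), its test.  Removing numbers that lie
between their neighbours, as in the typical sequences of Bodlaender and Kloks,
leaves boundedly many tests.  A test passed by A_(i+1) is passed by A_i, and the
test of a layout of H_i of width at most p is passed by A_i but not by A_(i+1),
otherwise G would have linear rank-width at most p.  So the length of the chain
is bounded by the number of tests.
*)

Set Implicit Arguments.
Unset Strict Implicit.
Unset Printing Implicit Defensive.
Import GRing.Theory.
Local Open Scope ring_scope.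

(** * Rank of a matrix padded with zeros *)

Section RankEmbedding.
Variables (F : fieldType) (a b m n : nat).
Variables (h : 'I_a -> 'I_m) (k : 'I_b -> 'I_n).
Hypotheses (h_inj : injective h) (k_inj : injective k).

(** [B] is [N] padded with zero rows and columns, so it equals P_h^T N P_k for 0-1 matrices P_h, P_k
    of full row rank. *)
Lemma rank_embed (N : 'M[F]_(a, b)) (B : 'M[F]_(m, n)) :
  (forall i j, B (h i) (k j) = N i j) ->
  (forall i j, i \notin codom h -> B i j = 0) ->
  (forall i j, j \notin codom k -> B i j = 0) ->
  \rank B = \rank N.
Proof.
move=> BN B0l B0r.
pose P c d (g : 'I_c -> 'I_d) : 'M[F]_(c, d) := \matrix_(i, j) (j == g i)%:R.
have Pfree c d (g : 'I_c -> 'I_d) : injective g -> row_free (P c d g).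
  move=> g_inj; apply/row_freeP; exists (P c d g)^T.
  apply/matrixP=> i j; rewrite !mxE (bigD1 (g i)) //= big1 => [|l /negPf li].
    by rewrite !mxE eqxx mul1r addr0 (inj_eq g_inj).
  by rewrite !mxE li mul0r.
have -> : B = (P _ _ h)^T *m N *m P _ _ k.
  apply/matrixP=> i j; rewrite !mxE.
  under eq_bigr => l _ do rewrite !mxE.
  have [/codomP[j' ->]|jk] := boolP (j \in codom k); last first.
    rewrite B0r // big1 // => l _.
    case: eqP => [jl|_]; last by rewrite mulr0.
    by rewrite jl codom_f in jk.
  rewrite (bigD1 j') //= eqxx mulr1 [X in _ + X]big1 ?addr0; last first.
    move=> l lj; rewrite (inj_eq k_inj) eq_sym (negPf lj) mulr0 //.
  have [/codomP[i' ->]|ih] := boolP (i \in codom h); last first.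
    rewrite B0l // big1 // => l _; rewrite !mxE.
    case: eqP => [il|_]; last by rewrite mul0r.
    by rewrite il codom_f in ih.
  rewrite (bigD1 i') //= !mxE eqxx mul1r big1 ?addr0 ?BN // => l li.
  by rewrite !mxE (inj_eq h_inj) eq_sym (negPf li) mul0r.
rewrite mxrankMfree ?Pfree // -mxrank_tr trmx_mul trmxK mxrankMfree ?Pfree //.
exact: mxrank_tr.
Qed.

End RankEmbedding.

(** * Vectors indexed by vertices and ranks of submatrices *)

Section Coordinates.
Variables (F : fieldType) (V : finType).
Implicit Types (G : star_graph F V) (R C X Y : {set V}) (u : 'rV[F]_#|V|).

Definition coord u (v : V) : F := u 0 (enum_rank v).

Definition adjm G : 'M[F]_#|V| := \matrix_(i, j) G (enum_val i) (enum_val j).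

Definition out G u (v : V) : F := coord (u *m adjm G) v.

Lemma coordP u w : (forall v, coord u v = coord w v) -> u = w.
Proof.
by move=> uw; apply/rowP=> i; have := uw (enum_val i); rewrite /coord enum_valK.
Qed.

Lemma coordD u w v : coord (u + w) v = coord u v + coord w v.
Proof. by rewrite /coord mxE. Qed.

Lemma coordB u w v : coord (u - w) v = coord u v - coord w v.
Proof. by rewrite /coord !mxE. Qed.

Lemma coord0 v : coord 0 v = 0.
Proof. by rewrite /coord mxE. Qed.

Lemma outD G u w v : out G (u + w) v = out G u v + out G w v.
Proof. by rewrite /out mulmxDl coordD. Qed.

Lemma outB G u w v : out G (u - w) v = out G u v - out G w v.
Proof. by rewrite /out mulmxBl coordB. Qed.

Lemma coord_mul u (N : 'M[F]_#|V|) v :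
  coord (u *m N) v = \sum_s coord u s * N (enum_rank s) (enum_rank v).
Proof.
rewrite /coord mxE (reindex (@enum_rank V)) //=.
by apply: onW_bij; exact: enum_rank_bij.
Qed.

Lemma outE G u v : out G u v = \sum_s coord u s * G s v.
Proof.
by rewrite /out coord_mul; apply: eq_bigr => s _; rewrite mxE !enum_rankK.
Qed.

Definition vmask X : 'M[F]_#|V| := diag_mx (\row_i (enum_val i \in X)%:R).

Lemma coord_mask u X v : coord (u *m vmask X) v = coord u v *+ (v \in X).
Proof. by rewrite /coord mul_mx_diag !mxE enum_rankK mulr_natr. Qed.

Lemma sub_mask u X : (u <= vmask X)%MS <-> forall v, v \notin X -> coord u v = 0.
Proof.
split=> [/submxP[w ->] v /negPf vX|u0]; first by rewrite coord_mask vX.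
suff -> : u = u *m vmask X by exact: submxMl.
apply: coordP => v; rewrite coord_mask; case: (boolP (v \in X)) => // /u0.
by move->.
Qed.

(** Rank of the submatrix with rows R and columns C. It is masked rather than extracted, so that all
    choices of R and C share one ambient space. *)
Definition rk G R C : nat := \rank (vmask R *m (adjm G *m vmask C)).

Lemma rk_matrixE G R C i j :
  (vmask R *m (adjm G *m vmask C)) i j =
  G (enum_val i) (enum_val j) *+ ((enum_val i \in R) && (enum_val j \in C)).
Proof.
rewrite mul_diag_mx mxE mul_mx_diag !mxE.
by case: (_ \in R); case: (_ \in C); rewrite ?mul1r ?mul0r ?mulr1 ?mulr0.
Qed.

Lemma rank_mask X : \rank (vmask X) = #|X|.
Proof.
rewrite -[RHS](mxrank1 F).
pose h (i : 'I_#|X|) := enum_rank (enum_val i).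
have h_inj : injective h by move=> i j /enum_rank_inj/enum_val_inj.
have hP i : i \notin codom h -> enum_val i \notin X.
  apply: contra => iX; apply/codomP; exists (enum_rank_in iX (enum_val i)).
  by rewrite /h enum_rankK_in // enum_valK.
apply: (rank_embed h_inj h_inj) => [i j|i j /hP/negPf ni|i j /hP/negPf nj].
- rewrite !mxE !enum_rankK !enum_valP (inj_eq h_inj).
  by case: eqP.
- by rewrite !mxE ni mul0rn.
by rewrite !mxE; case: eqP => // ->; rewrite nj.
Qed.

(** Left kernel of the R by C submatrix, padded by zeros. For C the complement of R it is the cut
    space of R. *)
Definition ksp G R C : 'M[F]_#|V| := (vmask R :&: kermx (adjm G *m vmask C))%MS.

Lemma kspP G R C u :
  reflect ((forall v, v \notin R -> coord u v = 0) /\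
           (forall v, v \in C -> out G u v = 0))
          (u <= ksp G R C)%MS.
Proof.
rewrite sub_capmx; apply: (iffP andP) => -[].
  move=> /sub_mask uR /sub_kermxP; rewrite mulmxA => uC; split=> // v vC.
  by have := coord_mask (u *m adjm G) C v; rewrite uC coord0 vC.
move=> uR uC; split; first exact/sub_mask.
apply/sub_kermxP/coordP => v; rewrite mulmxA coord_mask coord0.
by case: (boolP (v \in C)) => // vC; exact: uC.
Qed.

Lemma rank_ksp G R C : (rk G R C + \rank (ksp G R C))%N = #|R|.
Proof. by rewrite mxrank_mul_ker rank_mask. Qed.

(** By rank-nullity this is a statement on kernels: the intersection and the sum of the two kernels
    on the right lie in the two kernels on the left, and dimensions and cardinals are modular. *)
Lemma rk_submod G R1 C1 R2 C2 :
  (rk G (R1 :&: R2) (C1 :|: C2) + rk G (R1 :|: R2) (C1 :&: C2) <=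
   rk G R1 C1 + rk G R2 C2)%N.
Proof.
have E1 := rank_ksp G R1 C1; have E2 := rank_ksp G R2 C2.
have EI := rank_ksp G (R1 :&: R2) (C1 :|: C2).
have EU := rank_ksp G (R1 :|: R2) (C1 :&: C2).
have EC := cardsUI R1 R2.
have sI : (ksp G R1 C1 :&: ksp G R2 C2 <= ksp G (R1 :&: R2) (C1 :|: C2))%MS.
  apply/rV_subP=> u; rewrite sub_capmx => /andP[/kspP[a1 b1] /kspP[a2 b2]].
  apply/kspP; split=> v; rewrite !inE.
    by rewrite negb_and => /orP[/a1|/a2].
  by case/orP=> [/b1|/b2].
have sU : (ksp G R1 C1 + ksp G R2 C2 <= ksp G (R1 :|: R2) (C1 :&: C2))%MS.
  rewrite addsmx_sub; apply/andP; split; apply/rV_subP => u /kspP[a0 b0];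
    apply/kspP; split=> v; rewrite !inE.
  - by rewrite negb_or => /andP[/a0].
  - by case/andP=> /b0.
  - by rewrite negb_or => /andP[_ /a0].
  by case/andP=> _ /b0.
have := mxrank_sum_cap (ksp G R1 C1) (ksp G R2 C2).
have := mxrankS sI; have := mxrankS sU.
move: E1 E2 EI EU EC; do 4 move: (rk _ _ _); do 4 move: (\rank (ksp _ _ _)).
by move=> *; lia.
Qed.

Lemma rk_le_size G R C : (rk G R C <= #|R|)%N.
Proof. by rewrite -(rank_ksp G R C) leq_addr. Qed.



End Coordinates.

(** * Cut-rank of a graph and of its induced subgraphs *)

Section CutRank.
Variables (F : fieldType) (V : finType).
Implicit Types (G : star_graph F V) (R C X U : {set V}).

Lemma rk_addv G X C v : (rk G (v |: X) C <= (rk G X C).+1)%N.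
Proof.
have := rk_submod G X C [set v] C; rewrite setUid setIid setUC.
by have := rk_le_size G [set v] C; rewrite cards1; lia.
Qed.

Lemma cutrk_rk G X : cutrk G X = rk G X (~: X).
Proof.
pose h (Y : {set V}) (i : 'I_#|Y|) := enum_rank (enum_val i).
have h_inj Y : injective (h Y) by move=> i j /enum_rank_inj/enum_val_inj.
have hP Y i : i \notin codom (h Y) -> enum_val i \notin Y.
  apply: contra => iX; apply/codomP; exists (enum_rank_in iX (enum_val i)).
  by rewrite /h enum_rankK_in // enum_valK.
apply/esym/(rank_embed (h_inj X) (h_inj (~: X))) => [i j|i j|i j];
  rewrite rk_matrixE.
- by rewrite !enum_rankK !mxE !enum_valP.
- by move=> /hP/negPf->.
by move=> /hP/negPf->; rewrite andbF.
Qed.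

Lemma cutrk_induced G U (X : {set {x : V | x \in U}}) :
  cutrk (induced G U) X = rk G (val @: X) (U :\: val @: X).
Proof.
pose h (Y : {set {x : V | x \in U}}) (i : 'I_#|Y|) :=
  enum_rank (val (enum_val i)).
have h_inj Y : injective (h Y).
  by move=> i j /enum_rank_inj/val_inj/enum_val_inj.
have hP Y i : i \notin codom (h Y) -> enum_val i \notin val @: Y.
  apply: contra => /imsetP[y yY iy]; apply/codomP.
  exists (enum_rank_in yY y).
  by rewrite /h enum_rankK_in // -iy enum_valK.
have valC : U :\: val @: X = val @: (~: X).
  apply/setP=> v; rewrite !inE; apply/andP/imsetP => [[vX vU]|[w]].
    exists (exist _ v vU) => //; rewrite inE; apply: contra vX => vX.
    by apply/imsetP; exists (exist _ v vU).
  rewrite inE => wX ->; split; last exact: (valP w).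
  by apply: contra wX => /imsetP[w' w'X /val_inj->].
rewrite valC.
apply/esym/(rank_embed (h_inj X) (h_inj (~: X))) => [i j|i j|i j];
  rewrite rk_matrixE.
- by rewrite !enum_rankK !mxE !imset_f ?enum_valP.
- by move=> /hP/negPf->.
by move=> /hP/negPf->; rewrite andbF.
Qed.

Lemma rk_empty G R : rk G R set0 = 0%N.
Proof.
apply/eqP; rewrite mxrank_eq0; apply/eqP/matrixP=> i j.
by rewrite rk_matrixE inE andbF mulr0n mxE.
Qed.

Lemma rk_empty_l G C : rk G set0 C = 0%N.
Proof. by apply/eqP; rewrite -leqn0 (leq_trans (rk_le_size _ _ _)) ?cards0. Qed.

End CutRank.

(** * Pivots *)

Section SesquiMorphism.
Variables (F : fieldType) (sigma : F -> F).
Hypothesis sesqui : sesqui_morphism sigma.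

(** Involutivity gives f(sigma 1) = sigma(sigma 1) / sigma 1 = 1 / sigma 1. *)
Lemma sesquiE : exists2 f : {rmorphism F -> F},
  forall a, sigma a = sigma 1 * f a & sigma 1 != 0 /\ f (sigma 1) = (sigma 1)^-1.
Proof.
case: sesqui => _ inv [f [_ fE]].
have s0 : sigma 1 != 0.
  apply/eqP=> s0; have := fE 1; rewrite rmorph1 s0 mul0r => /eqP.
  by rewrite oner_eq0.
exists f => [a|]; first by rewrite fE mulrC divfK.
by split=> //; rewrite fE inv mul1r.
Qed.

Variable V : finType.
Implicit Types (G : star_graph F V) (R C : {set V}).

Lemma sesqui_eq0 a : (sigma a == 0) = (a == 0).
Proof.
have [f fE [s0 _]] := sesquiE.
by rewrite fE mulf_eq0 (negPf s0) /= fmorph_eq0.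
Qed.

Lemma symmetric_adj0 G x y :
  sigma_symmetric sigma G -> (G x y == 0) = (G y x == 0).
Proof. by move=> symG; rewrite symG sesqui_eq0. Qed.

(** Transposing one submatrix gives the other up to [f] applied entrywise and the factor [sigma 1];
    neither changes the rank. *)
Lemma rk_sym G R C : sigma_symmetric sigma G -> rk G R C = rk G C R.
Proof.
move=> symG; have [f fE [s0 _]] := sesquiE.
rewrite /rk -[RHS]mxrank_tr -[RHS](mxrank_map f) -[RHS](mxrank_scale_nz _ s0).
congr (\rank _); apply/matrixP=> i j.
rewrite [RHS]mxE [X in _ * X]mxE [X in f X]mxE !rk_matrixE andbC.
by case: (_ && _); rewrite ?mulr0n ?rmorph0 ?mulr0 // !mulr1n symG fE.
Qed.

(** Since [f] sends G a b to G b a / sigma 1, every case of the definition of a pivot becomes an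
    identity of rational expressions in the entries. *)
Lemma pivot_symmetric G x y :
  sigma_symmetric sigma G -> G x y != 0 ->
  sigma_symmetric sigma (pivot sigma G x y).
Proof.
move=> symG xy0; have [f fE [s0 fs]] := sesquiE.
have yx0 : G y x != 0 by rewrite symmetric_adj0.
have sG a b : f (G a b) = G b a / sigma 1.
  by rewrite (symG b a) fE mulrC mulKf.
have xy : x != y by apply: contraNneq xy0 => ->; rewrite adj_loopless.
move=> s t; rewrite [RHS]fE /= /pivot_adj eq_sym.
have [_|st] := eqVneq t s; first by rewrite rmorph0 mulr0.
have [sx|sx] := eqVneq s x; have [tx|tx] := eqVneq t x;
  have [sy|sy] := eqVneq s y; have [ty|ty] := eqVneq t y;
  try by rewrite sx tx eqxx in st.
all: try by rewrite sy ty eqxx in st.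
all: try by rewrite -sx -sy eqxx in xy.
all: try by rewrite -tx -ty eqxx in xy.
all: rewrite ?sx ?tx ?sy ?ty.
all: rewrite ?(rmorphB, rmorphN, rmorphM, rmorphD, rmorphXn, fmorphV, rmorph1).
all: rewrite /= ?rmorphM ?fmorphV /= ?sG ?fs.
all: field; rewrite ?s0 ?xy0 ?yx0 //.
Qed.

End SesquiMorphism.

(** * The linear map of a pivot *)

Section PivotTransform.
Variables (F : fieldType) (sigma : F -> F) (V : finType).
Variables (G : star_graph F V) (x y : V).
Hypotheses (s0 : sigma 1 != 0) (xy0 : G x y != 0) (yx0 : G y x != 0).
Let G' := pivot sigma G x y.

(** Carries a vector u of the pivot to a vector of G: at x and y its entries are those of uM',
    scaled by -1/sigma(1) and -1, and elsewhere those of u. *)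
Definition pivot_mx : 'M[F]_#|V| := \matrix_(i, j)
  if enum_val j == x then - (sigma 1)^-1 * G' (enum_val i) x
  else if enum_val j == y then - G' (enum_val i) y
  else (i == j)%:R.

Lemma pivot_neq : x != y.
Proof. by apply: contraNneq xy0 => ->; rewrite adj_loopless. Qed.

Lemma pivot_coord u v :
  coord (u *m pivot_mx) v =
  if v == x then - (sigma 1)^-1 * out G' u x
  else if v == y then - out G' u y else coord u v.
Proof.
rewrite coord_mul; under eq_bigr => s _ do rewrite mxE !enum_rankK.
case: eqP => [_|/eqP vx].
  by rewrite outE mulr_sumr; apply: eq_bigr => s _; rewrite mulrCA.
case: eqP => [_|/eqP vy].
  by rewrite outE -sumrN; apply: eq_bigr => s _; rewrite mulrN.
rewrite (bigD1 v) //= eqxx mulr1 big1 ?addr0 // => s /negPf sv.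
by rewrite (inj_eq enum_rank_inj) sv mulr0.
Qed.

Let sum3 (f : V -> F) :
  \sum_s f s = f x + f y + \sum_(s | (s != x) && (s != y)) f s.
Proof.
rewrite (bigD1 x) //= (bigD1 y) 1?eq_sym ?pivot_neq //=.
by rewrite addrA.
Qed.

Lemma pivot_out_x u : out G (u *m pivot_mx) x = coord u x.
Proof.
have xy := pivot_neq; have yx : y != x by rewrite eq_sym.
rewrite outE sum3 !pivot_coord eqxx (negPf yx) eqxx adj_loopless mulr0 add0r.
under eq_bigr => s /andP[/negPf sx /negPf sy] do rewrite pivot_coord sx sy.
rewrite outE sum3 /= /pivot_adj !eqxx (negPf xy) (negPf yx).
under [X in - (_ + X)]eq_bigr => s /andP[/negPf sx /negPf sy] do
  rewrite sx sy mulrA.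
by rewrite -mulr_suml; field; rewrite yx0.
Qed.

Lemma pivot_out_y u : out G (u *m pivot_mx) y = sigma 1 * coord u y.
Proof.
have xy := pivot_neq; have yx : y != x by rewrite eq_sym.
rewrite outE sum3 !pivot_coord !eqxx (negPf yx) adj_loopless mulr0 addr0.
under eq_bigr => s /andP[/negPf sx /negPf sy] do rewrite pivot_coord sx sy.
rewrite outE sum3 /= /pivot_adj !eqxx (negPf yx).
under [X in _ * (_ + X) * _]eq_bigr => s /andP[/negPf sx /negPf sy] do
  rewrite sx sy mulrA mulrCA.
by rewrite -mulr_suml -mulr_sumr; field; rewrite xy0 s0.
Qed.

Lemma pivot_out v : v != x -> v != y ->
  exists d, forall u, out G (u *m pivot_mx) v = out G' u v + d * coord u v.
Proof.
move=> vx vy; have xy := pivot_neq; have yx : y != x by rewrite eq_sym.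
(* This is the value that the formula for distinct s and t would give at s = t = v; [pivot_adj] puts
   0 there, hence the correction term. *)
exists (- (G v x * G y v / G y x + G v y * G x v / G x y)) => u.
pose a := \sum_(s | (s != x) && (s != y)) coord u s * G s x.
pose b := \sum_(s | (s != x) && (s != y)) coord u s * G s y.
pose g := \sum_(s | (s != x) && (s != y)) coord u s * G s v.
have ox : out G' u x = coord u y * - (sigma 1 ^+ 2 / G x y) + sigma 1 * b / G x y.
  rewrite outE sum3 /= /pivot_adj !eqxx (negPf yx) mulr0 add0r; congr (_ + _).
  rewrite mulr_sumr mulr_suml; apply: eq_bigr => s /andP[/negPf-> /negPf->].
  by ring.
have oy : out G' u y = coord u x * - (1 / G y x) + a / G y x.
  rewrite outE sum3 /= /pivot_adj !eqxx (negPf yx) (negPf xy) mulr0 addr0.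
  congr (_ + _).
  rewrite mulr_suml; apply: eq_bigr => s /andP[/negPf-> /negPf->].
  by ring.
rewrite outE sum3 !pivot_coord !eqxx (negPf yx) ox oy.
under eq_bigr => s /andP[/negPf sx /negPf sy] do rewrite pivot_coord sx sy.
rewrite -/g outE sum3 /= /pivot_adj eqxx (negPf yx) eqxx.
rewrite !(eq_sym _ v) (negPf vx) (negPf vy).
have -> : \sum_(s | (s != x) && (s != y)) coord u s *
    (if s == v then 0 else if s == x then G y v / G y x
     else if s == y then sigma 1 * G x v / G x y
     else G s v - G s x * G y v / G y x - G s y * G x v / G x y) =
   g - a * (G y v / G y x) - b * (G x v / G x y) +
   coord u v * (G v x * G y v / G y x + G v y * G x v / G x y).
  rewrite /g /a /b !mulr_suml -!sumrB.
  rewrite !(bigD1 v (P := fun s => (s != x) && (s != y))) ?vx ?vy //=.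
  rewrite eqxx adj_loopless mulr0 add0r.
  under eq_bigr => s /andP[/andP[/negPf sx /negPf sy] /negPf sv] do
    rewrite sx sy sv.
  set S := (X in X = _); set S' := (X in _ = _ + X + _).
  have -> : S = S' by apply: eq_bigr => s _; ring.
  by ring.
by field; rewrite xy0 yx0 s0.
Qed.

End PivotTransform.

(** * Linking *)

Section LocalIsomorphism.
Variables (F : fieldType) (V : finType).
Implicit Types (G : star_graph F V) (Phi Psi : 'M[F]_#|V|).

Definition null G u v := (coord u v == 0) && (out G u v == 0).

(** All that is kept of a sequence of pivots: vertexwise vanishing of the pair (u, uM) is preserved,
    which suffices to transport cut spaces. *)
Definition local_iso G G' Phi :=
  row_free Phi /\ forall u v, null G (u *m Phi) v = null G' u v.

Lemma local_iso_refl G : local_iso G G 1%:M.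
Proof. by split=> [|u v]; rewrite ?mulmx1 // row_free_unit unitmx1. Qed.

Lemma local_iso_trans G1 G2 G3 Phi Psi :
  local_iso G1 G2 Phi -> local_iso G2 G3 Psi -> local_iso G1 G3 (Psi *m Phi).
Proof.
move=> [f1 n1] [f2 n2]; split=> [|u v]; last by rewrite mulmxA n1 n2.
by rewrite row_free_unit unitmx_mul -!row_free_unit f1 f2.
Qed.

Lemma rank_preim Phi m1 m2 (A : 'M_(m1, #|V|)) (B : 'M_(m2, #|V|)) :
  row_free Phi -> (forall u : 'rV_#|V|, (u <= A)%MS = (u *m Phi <= B)%MS) ->
  \rank A = \rank B.
Proof.
move=> fPhi AB; rewrite -(mxrankMfree A fPhi).
apply/eqmx_rank/andP; split; apply/rV_subP => u.
  by case/submxP=> w ->; rewrite mulmxA -AB submxMl.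
have uPhi : Phi \in unitmx by rewrite -row_free_unit.
move=> uB; rewrite -(mulmxKV uPhi u) submxMr // AB.
by rewrite mulmxKV.
Qed.

Section Pivot.
Variables (sigma : F -> F) (G : star_graph F V) (x y : V).
Hypotheses (s0 : sigma 1 != 0) (xy0 : G x y != 0) (yx0 : G y x != 0).

Lemma pivot_local_iso :
  local_iso G (pivot sigma G x y) (pivot_mx sigma G x y).
Proof.
split=> [|u v].
  apply: inj_row_free => u uP0; apply: coordP => v; rewrite coord0.
  have := pivot_coord sigma G x y u v; rewrite uP0 coord0.
  case: eqP => [-> _|_].
    by rewrite -(pivot_out_x sigma xy0 yx0) uP0 /out mul0mx coord0.
  case: eqP => [-> _|_ <-] //.
  have := pivot_out_y s0 xy0 u; rewrite uP0 /out mul0mx coord0 => /esym.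
  by move/eqP; rewrite mulf_eq0 (negPf s0) => /eqP.
have yx : y != x by rewrite eq_sym (pivot_neq xy0).
rewrite /null pivot_coord; case: (eqVneq v x) => [->|vx].
  rewrite (pivot_out_x sigma xy0 yx0) andbC mulf_eq0 oppr_eq0 invr_eq0 (negPf s0) //.
case: (eqVneq v y) => [->|vy].
  by rewrite (pivot_out_y s0 xy0) andbC oppr_eq0 mulf_eq0 (negPf s0).
have [d ->] := pivot_out s0 xy0 yx0 vx vy.
by case: eqP => // ->; rewrite mulr0 addr0.
Qed.

(** The map of the pivot identifies the two kernels, while the row set grows by x. At x the
    condition on u becomes one on uM; at y both conditions or none are imposed, as y lies in exactly
    one of R and C; elsewhere the correction term vanishes on C because C avoids R. *)
Lemma rk_pivot (R C : {set V}) :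
  x \notin R -> x \notin C -> [disjoint R & C] -> y \in R :|: C ->
  rk G (x |: R) (x |: C) = (rk (pivot sigma G x y) R C).+1.
Proof.
move=> xR xC dRC yRC.
have yx : y != x by rewrite eq_sym (pivot_neq xy0).
suff : \rank (ksp (pivot sigma G x y) R C) = \rank (ksp G (x |: R) (x |: C)).
  have := rank_ksp G (x |: R) (x |: C); rewrite cardsU1 xR.
  by have := rank_ksp (pivot sigma G x y) R C; lia.
have [fPhi _] := pivot_local_iso.
have notR v : v \in C -> v \notin R.
  by move=> vC; apply/negP=> /(disjointFr dRC); rewrite vC.
have xNC v : v \in C -> v != x by move=> vC; apply: contraNneq xC => <-.
have yC : y \notin R -> y \in C by move=> yR; case/setUP: yRC yR => // ->.
apply: (rank_preim fPhi) => u; apply/kspP/kspP => -[uR uC]; split=> v.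
- rewrite !inE negb_or => /andP[/negPf vx vR]; rewrite pivot_coord vx.
  by case: eqP => [vy|_]; [rewrite uC ?oppr0 // yC // -vy | exact: uR].
- rewrite !inE => /orP[/eqP->|vC].
    by rewrite (pivot_out_x sigma xy0 yx0) uR.
  have [vy|vy] := eqVneq v y.
    by rewrite vy (pivot_out_y s0 xy0) uR ?mulr0 // -vy notR.
  have [d ->] := pivot_out s0 xy0 yx0 (xNC _ vC) vy.
  by rewrite uC // uR ?notR // mulr0 addr0.
- move=> vR; have [->|vx] := eqVneq v x.
    by rewrite -(pivot_out_x sigma xy0 yx0) uC // setU11.
  have [vy|vy] := eqVneq v y.
    have := pivot_out_y s0 xy0 u; rewrite uC; last first.
      by rewrite !inE yC ?orbT // -vy.
    by move/esym/eqP; rewrite mulf_eq0 (negPf s0) vy => /eqP.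
  have := uR v; rewrite pivot_coord (negPf vx) (negPf vy); apply.
  by rewrite !inE negb_or vx.
move=> vC; have vx := xNC _ vC.
have vxR : v \notin x |: R by rewrite !inE negb_or vx notR.
have := uR v vxR; rewrite pivot_coord (negPf vx).
have [-> /eqP|vy uv] := eqVneq v y; first by rewrite oppr_eq0 => /eqP.
have [d dE] := pivot_out s0 xy0 yx0 vx vy.
have := uC v; rewrite dE uv mulr0 addr0; apply.
by rewrite !inE vC orbT.
Qed.

End Pivot.

End LocalIsomorphism.

(** * Removing vertices without losing connectivity *)

Section Linking.
Variables (F : fieldType) (sigma : F -> F) (V : finType).
Hypothesis sesqui : sesqui_morphism sigma.
Implicit Types (G : star_graph F V) (U A B C S : {set V}).

(** A minimum cut condition in the graph induced on U: separating A from B costs at least r. *)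
Definition linked G U A B r :=
  [forall S : {set V}, (A \subset S) && (S \subset U :\: B) ==>
     (r <= rk G S (U :\: S))%N].

Lemma linkedP G U A B r :
  reflect (forall S, A \subset S -> S \subset U :\: B ->
             (r <= rk G S (U :\: S))%N)
          (linked G U A B r).
Proof.
apply: (iffP forallP) => [GL S AS SB|GL S].
  by move: (GL S); rewrite AS SB.
by apply/implyP=> /andP[/GL]; apply.
Qed.

(* One of the two ways of removing v keeps the minimum cut at least r: if both
   lost a unit, submodularity would give two cuts of G with sum at most 2r-1. *)
Lemma linked_step G U A B r v :
  sigma_symmetric sigma G -> linked G U A B r ->
  v \in U -> v \notin A -> v \notin B ->
  exists G' Phi, [/\ G' = G \/ (exists2 w, G v w != 0 & G' = pivot sigma G v w),
    local_iso G G' Phi & linked G' (U :\ v) A B r].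
Proof.
move=> symG /linkedP GL vU vA vB.
have [GLv|] := boolP (linked G (U :\ v) A B r).
  by exists G, 1%:M; split=> //; [left | exact: local_iso_refl].
rewrite negb_forall => /existsP[X]; rewrite negb_imply => /andP[/andP[AX XB]].
rewrite -ltnNge => rkX.
have vX : v \notin X by apply/negP => /(subsetP XB); rewrite !inE eqxx andbF.
have XU : X \subset U :\: B.
  apply: subset_trans XB _; apply/subsetP => w; rewrite !inE.
  by case/and3P=> -> _ ->.
(* Without a neighbour in U, the column of v contributes nothing to the cut of X, which contradicts
   [GL]. Otherwise pivot on v and a neighbour w. *)
have [/existsP[w /andP[wU vw0]]|] := boolP [exists w in U, G v w != 0]; last first.
  rewrite negb_exists => /forallP noN.
  have := GL X AX XU; have := rank_ksp G X (U :\: X).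
  have := rank_ksp G X ((U :\ v) :\: X).
  suff /mxrankS : (ksp G X ((U :\ v) :\: X) <= ksp G X (U :\: X))%MS by lia.
  apply/rV_subP=> u /kspP[uX uU]; apply/kspP; split=> // t tUX.
  have [->|tv] := eqVneq t v; last by apply: uU; rewrite in_setD in_setD1 tv -in_setD.
  rewrite outE big1 // => s _; case: (boolP (s \in X)) => [sX|/uX->]; last first.
    by rewrite mul0r.
  have := noN s; rewrite negb_and negbK.
  have /setDP[-> _] := subsetP XU s sX; rewrite /= (symmetric_adj0 sesqui _ _ symG).
  by move=> /eqP->; rewrite mulr0.
have wv0 : G w v != 0 by rewrite (symmetric_adj0 sesqui).
have [_ _ [s0 _]] := sesquiE sesqui.
exists (pivot sigma G v w), (pivot_mx sigma G v w); split.
- by right; exists w.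
- exact: pivot_local_iso.
have wv : w != v by rewrite eq_sym (pivot_neq vw0).
apply/linkedP=> Y AY YB; rewrite leqNgt; apply/negP => rkY.
have vY : v \notin Y by apply/negP => /(subsetP YB); rewrite !inE eqxx andbF.
have YU : Y \subset U :\: B.
  apply: subset_trans YB _; apply/subsetP => t; rewrite !inE.
  by case/and3P=> -> _ ->.
have dY : [disjoint Y & (U :\ v) :\: Y].
  by rewrite disjoints_subset; apply/subsetP => t tY; rewrite !inE tY.
have rkP : rk G (v |: Y) (v |: (U :\ v) :\: Y) =
           (rk (pivot sigma G v w) Y ((U :\ v) :\: Y)).+1.
  by apply: rk_pivot => //; rewrite !inE ?eqxx ?andbF // wv wU /= andbT orbN.
have EY : v |: (U :\ v) :\: Y = U :\: Y.
  apply/setP => t; rewrite !inE.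
  by have [->|] := eqVneq t v; rewrite ?vU ?vY.
rewrite EY in rkP.
(* The first pair of sets omits v from both rows and columns, the second has v in both, so
   intersection and union give true cuts of U, each of rank at least r. *)
have := rk_submod G X ((U :\ v) :\: X) (v |: Y) (U :\: Y).
rewrite rkP.
have -> : (U :\ v) :\: X :|: U :\: Y = U :\: (X :&: (v |: Y)).
  apply/setP => t; rewrite !inE.
  have [->|_] := eqVneq t v; rewrite ?(negPf vX) ?(negPf vY) ?vU //=.
  by case: (t \in X); case: (t \in Y); case: (t \in U).
have -> : ((U :\ v) :\: X) :&: (U :\: Y) = U :\: (X :|: (v |: Y)).
  apply/setP => t; rewrite !inE.
  have [->|_] := eqVneq t v; rewrite ?(negPf vX) ?(negPf vY) ?vU //=.
  by case: (t \in X); case: (t \in Y); case: (t \in U).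
have s1 : (r <= rk G (X :&: (v |: Y)) (U :\: (X :&: (v |: Y))))%N.
  apply: GL; last exact: subset_trans (subsetIl _ _) XU.
  by rewrite subsetI AX (subset_trans AY) ?subsetUr.
have s2 : (r <= rk G (X :|: (v |: Y)) (U :\: (X :|: (v |: Y))))%N.
  apply: GL; first exact: subset_trans AX (subsetUl _ _).
  rewrite !subUset XU YU sub1set !inE vU vB //.
by clear -s1 s2 rkX rkY => sub; lia.
Qed.

(** The vertices of C are treated one by one with [linked_step]. Deletions are recorded only by
    shrinking the vertex set considered, so all pivots compose to one map on the full space. *)
Lemma linking G A B r C :
  sigma_symmetric sigma G -> linked G setT A B r ->
  [disjoint C & A] -> [disjoint C & B] ->
  exists G' Phi, [/\ pivot_equivalent sigma G G', sigma_symmetric sigma G',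
    local_iso G G' Phi & linked G' (~: C) A B r].
Proof.
move=> symG GL; move: {2}#|C| (erefl #|C|) => m.
elim: m C => [|m IH] C cC dA dB.
  have -> : C = set0 by apply/eqP; rewrite -cards_eq0 cC.
  exists G, 1%:M; rewrite setC0; split=> //; first exact: pivot_equivalent_refl.
  exact: local_iso_refl.
have [v vC] : exists v, v \in C by apply/card_gt0P; rewrite cC.
have sC : C :\ v \subset C by exact: subsetDl.
have [||| G1 [Phi1 [eq1 sym1 iso1 L1]]] := IH (C :\ v).
- by move: cC; rewrite (cardsD1 v) vC => -[].
- exact: disjointWl sC dA.
- exact: disjointWl sC dB.
have [||| G2 [Phi2 [G2E iso2 L2]]] := linked_step sym1 L1 (v := v).
- by rewrite !inE eqxx.
- by rewrite (disjointFr dA).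
- by rewrite (disjointFr dB).
exists G2, (Phi2 *m Phi1); split.
- case: G2E => [->|[w vw0 ->]] //.
  exact: pivot_equivalent_step.
- case: G2E => [->|[w vw0 ->]] //.
  exact: pivot_symmetric.
- exact: local_iso_trans iso1 iso2.
suff <- : ~: (C :\ v) :\ v = ~: C by [].
by apply/setP=> t; rewrite !inE; case: eqVneq => // ->; rewrite vC.
Qed.
End Linking.

(** * Gluing cut spaces along a boundary *)

Section Subspaces.
Variables (F : fieldType) (n k : nat).

(** Project along W onto a complement of the overlap in Z, then apply [theta]; the overlap is
    harmless since [theta] kills it. *)
Lemma extend_by_zero (Z W : 'M[F]_n) (theta : 'M[F]_(n, k)) :
  (1%:M <= Z + W)%MS ->
  (forall u : 'rV_n, (u <= Z)%MS -> (u <= W)%MS -> u *m theta = 0) ->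
  exists theta' : 'M[F]_(n, k),
    (forall u : 'rV_n, (u <= Z)%MS -> u *m theta' = u *m theta) /\
    (forall u : 'rV_n, (u <= W)%MS -> u *m theta' = 0).
Proof.
move=> ZW ker0; have dxZW := capmx_diff Z W.
exists (proj_mx (Z :\: W)%MS W *m theta); split=> u uZ; rewrite mulmxA.
  have : (u <= (Z :\: W) + (Z :&: W))%MS by rewrite addsmx_diff_cap_eq.
  case/sub_addsmxP=> -[a b] /= uE.
  have bZ : (b *m (Z :&: W)%MS <= Z)%MS.
    exact: submx_trans (submxMl _ _) (capmxSl _ _).
  have bW : (b *m (Z :&: W)%MS <= W)%MS.
    exact: submx_trans (submxMl _ _) (capmxSr _ _).
  rewrite uE 2!mulmxDl [X in X *m theta + _](proj_mx_id dxZW) ?submxMl //.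
  rewrite [X in _ + X *m theta](proj_mx_0 dxZW) // mul0mx addr0.
  by rewrite mulmxDl (ker0 (b *m _)) ?addr0.
by rewrite (proj_mx_0 dxZW) ?mul0mx.
Qed.

Lemma kernel_of_subspace (W : 'M[F]_n) :
  (n <= \rank W + k)%N ->
  exists theta : 'M[F]_(n, k),
    forall u : 'rV_n, (u *m theta == 0) = (u <= W)%MS.
Proof.
move=> rW; pose B := cokermx W.
have rB : (\rank B <= k)%N by rewrite mxrank_coker leq_subLR.
exists (col_base B *m pid_mx (\rank B)) => u.
have fP : row_free (pid_mx (\rank B) : 'M[F]_(\rank B, k)).
  by rewrite /row_free rank_pid_mx.
by rewrite mulmxA mulmx_free_eq0 // -(mulmx_free_eq0 _ (row_base_free B))
  -mulmxA mulmx_base submxE.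
Qed.

(** Rank-nullity for [theta] on the vectors of P whose image lies in T. *)
Lemma rank_image_cap m (P : 'M[F]_(m, n)) (theta : 'M[F]_(n, k)) (T : 'M[F]_k) :
  (\rank ((P *m theta) :&: T) + \rank (P :&: kermx theta) =
   \rank (P :&: kermx (theta *m cokermx T)))%N.
Proof.
rewrite -(mxrank_mul_ker (P :&: kermx (theta *m cokermx T))%MS theta).
congr (_ + _)%N; apply/eqmx_rank/andP; split; apply/rV_subP=> u.
- rewrite sub_capmx => /andP[/submxP[w uE] uT]; rewrite uE mulmxA submxMr //.
  rewrite sub_capmx submxMl /=; apply/sub_kermxP.
  by rewrite mulmxA -[_ *m _ *m theta]mulmxA -uE; apply/eqP; rewrite -submxE.
- case/submxP=> w ->; rewrite sub_capmx mulmxA submxMr; last first.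
    exact: submx_trans (submxMl _ _) (capmxSl _ _).
  rewrite submxE -mulmxA; apply/eqP/sub_kermxP.
  exact: submx_trans (submxMl _ _) (capmxSr _ _).
- rewrite sub_capmx => /andP[uP uK]; rewrite !sub_capmx uP uK andbT /=.
  by move/sub_kermxP: uK => uK; apply/sub_kermxP; rewrite mulmxA uK mul0mx.
by rewrite !sub_capmx => /andP[/andP[-> _] ->].
Qed.

End Subspaces.

(** * Cut spaces and the merging of two sides *)

Section CutSpaces.
Variables (F : fieldType) (V : finType).
Implicit Types (G : star_graph F V) (A B C X Y S : {set V}) (u : 'rV[F]_#|V|).

Definition cutsp G X := ksp G X (~: X).
Definition lam G X := rk G X (~: X).

Lemma cutspP G X u :
  reflect (forall v, v \notin X -> null G u v) (u <= cutsp G X)%MS.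
Proof.
apply: (iffP (kspP _ _ _ _)) => [[u0 u1] v vX|uX].
  by rewrite /null u0 // u1 ?eqxx // inE.
split=> v vX; last by rewrite inE in vX; have /andP[_ /eqP] := uX v vX.
by have /andP[/eqP] := uX v vX.
Qed.

Lemma rank_cutsp G X : (lam G X + \rank (cutsp G X))%N = #|X|.
Proof. exact: rank_ksp. Qed.

Lemma null0 G u v : null G u v -> coord u v = 0.
Proof. by case/andP=> /eqP. Qed.

Lemma nullD G u w v : null G u v -> null G w v -> null G (u + w) v.
Proof.
move=> /andP[/eqP a /eqP b] /andP[/eqP c /eqP d].
by rewrite /null coordD outD a b c d !addr0 !eqxx.
Qed.

Lemma nullB G u w v : null G u v -> null G w v -> null G (u - w) v.
Proof.
move=> /andP[/eqP a /eqP b] /andP[/eqP c /eqP d].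
by rewrite /null coordB outB a b c d !subr0 !eqxx.
Qed.

Lemma cutspS G X Y : X \subset Y -> (cutsp G X <= cutsp G Y)%MS.
Proof.
move=> XY; apply/rV_subP => u /cutspP uX; apply/cutspP => v vY; apply: uX.
by apply: contra vY => /(subsetP XY).
Qed.

(** At a vertex of A outside S the B-part is null, hence so is the A-part, and symmetrically. *)
Lemma cutsp_cap G A B S u :
  [disjoint A & B] -> (u <= cutsp G A + cutsp G B)%MS -> (u <= cutsp G S)%MS ->
  (u <= cutsp G (S :&: A) + cutsp G (S :&: B))%MS.
Proof.
move=> dAB /sub_addsmxP[[a b] /= ->] abS.
have aA : (a *m cutsp G A <= cutsp G A)%MS by exact: submxMl.
have bB : (b *m cutsp G B <= cutsp G B)%MS by exact: submxMl.
move: aA bB abS; move: (a *m _) (b *m _) => {a b} a b.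
move=> /cutspP aA /cutspP bB /cutspP abS.
apply: addmx_sub_adds; apply/cutspP => v; rewrite inE negb_and.
  have [vA|/aA//] := boolP (v \in A); rewrite orbF => /abS abv.
  by rewrite -(addrK b a) nullB // bB // (disjointFr dAB).
have [vB|/bB//] := boolP (v \in B); rewrite orbF => /abS abv.
by rewrite -(addrK a b) [b + a]addrC nullB // aA // (disjointFl dAB).
Qed.

Lemma rank_cutspU G A B :
  [disjoint A & B] ->
  \rank (cutsp G A + cutsp G B) = (\rank (cutsp G A) + \rank (cutsp G B))%N.
Proof.
move=> dAB; apply: mxrank_disjoint_sum; apply/eqP; rewrite -submx0.
apply/rV_subP => u; rewrite sub_capmx => /andP[/cutspP uA /cutspP uB].
rewrite submx0; apply/eqP/coordP => v; rewrite coord0; apply: (@null0 G).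
have [vA|/uA//] := boolP (v \in A); apply: uB.
by rewrite (disjointFr dAB).
Qed.

(** [theta] is meant to kill the cut spaces of A and of its complement. The two sides are the images
    of the vectors that are null on A minus X, and on the complement of A minus Y. *)
Definition xside k G A (theta : 'M[F]_(#|V|, k)) X :=
  cutsp G (X :|: ~: A) *m theta.
Definition yside k G A (theta : 'M[F]_(#|V|, k)) Y :=
  cutsp G (Y :|: A) *m theta.

(* Z stands for a minor on A and B obtained from G: the vectors of the cut space
   of X :|: Y in the minor are the vectors of Z supported on X :|: Y and the
   removed vertices, and theta glues the two sides along the boundary. *)
Lemma rank_merge k G A B (Z : 'M[F]_#|V|) (theta theta' : 'M[F]_(#|V|, k)) X Y :
  [disjoint A & B] ->
  (forall u, (u <= Z)%MS -> u *m theta = u *m theta') ->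
  (cutsp G A <= Z)%MS -> (cutsp G B <= Z)%MS ->
  (1%:M <= Z + cutsp G (~: A))%MS -> (1%:M <= Z + cutsp G (~: B))%MS ->
  (forall u, (u <= cutsp G (~: A))%MS -> u *m theta = 0) ->
  (forall u, (u <= cutsp G (~: B))%MS -> u *m theta' = 0) ->
  (forall u, (u <= Z)%MS -> u *m theta' = 0 ->
     (u <= cutsp G A + cutsp G B)%MS) ->
  X \subset A -> Y \subset B ->
  \rank (Z :&: cutsp G (X :|: Y :|: ~: (A :|: B))) =
  (\rank (cutsp G X) + \rank (cutsp G Y) +
   \rank (xside G A theta X :&: yside G (~: B) theta' Y))%N.
Proof.
move=> dAB eqZ ZA ZB fullA fullB kA kB kZ XA YB.
have dXY : [disjoint X & Y] by exact: disjointW XA YB dAB.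
have AnB : A \subset ~: B by rewrite -disjoints_subset.
have BnA : B \subset ~: A by rewrite -disjoints_subset disjoint_sym.
(* Rank-nullity for [theta] on [N]: its kernel is the sum of the cut spaces of X and Y, its image
   the intersection of the two sides. *)
set N := (Z :&: _)%MS; rewrite -(mxrank_mul_ker N theta) addnC.
have subS v : v \in X :|: Y :|: ~: (A :|: B) ->
    (v \in X :|: ~: A) && (v \in Y :|: ~: B).
  rewrite !inE => /orP[/orP[vX|vY]|];
    last by rewrite negb_or => /andP[-> ->]; rewrite !orbT.
    by have := subsetP AnB v (subsetP XA v vX); rewrite vX inE => ->; rewrite orbT.
  by have := subsetP BnA v (subsetP YB v vY); rewrite vY inE => ->; rewrite orbT.
congr (_ + _)%N.
  rewrite -rank_cutspU //; apply/eqmx_rank/andP; split; apply/rV_subP => u.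
    rewrite sub_capmx => /andP[]; rewrite sub_capmx => /andP[uZ uS] /sub_kermxP.
    rewrite eqZ // => /(kZ _ uZ) /(cutsp_cap dAB)/(_ uS).
    have -> : (X :|: Y :|: ~: (A :|: B)) :&: A = X.
      apply/setP => v; rewrite !inE; have [vA|vA] := boolP (v \in A).
        rewrite orbF andbT; case: (boolP (v \in Y)); rewrite ?orbF //.
        by move/(subsetP YB)/(subsetP BnA); rewrite inE vA.
      by rewrite andbF; apply/esym/negP => /(subsetP XA); rewrite (negPf vA).
    have -> // : (X :|: Y :|: ~: (A :|: B)) :&: B = Y.
    apply/setP => v; rewrite !inE; have [vB|vB] := boolP (v \in B).
      rewrite orbT orbF andbT; case: (boolP (v \in X)); rewrite ?orbF //.
      by move/(subsetP XA)/(subsetP AnB); rewrite inE vB.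
    by rewrite andbF; apply/esym/negP => /(subsetP YB); rewrite (negPf vB).
  case/sub_addsmxP=> -[a b] /= ->.
  have aX : (a *m cutsp G X <= cutsp G X)%MS by exact: submxMl.
  have bY : (b *m cutsp G Y <= cutsp G Y)%MS by exact: submxMl.
  move: aX bY; move: (a *m _) (b *m _) => {a b} a b aX bY.
  have aA := submx_trans aX (cutspS G XA); have bB := submx_trans bY (cutspS G YB).
  rewrite sub_capmx [X in X && _]sub_capmx addmx_sub //=; last 2 first.
  - exact: submx_trans aA ZA.
  - exact: submx_trans bB ZB.
  apply/andP; split.
    apply: addmx_sub; [apply: submx_trans aX _|apply: submx_trans bY _];
      by apply: cutspS; apply/subsetP => v vX; rewrite !inE vX ?orbT.
  apply/sub_kermxP; rewrite mulmxDl eqZ ?(submx_trans aA) //.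
  rewrite kB ?kA ?addr0 //.
    by apply: submx_trans bB _; exact: cutspS.
  by apply: submx_trans aA _; exact: cutspS.
apply/eqmx_rank/andP; split; apply/rV_subP => u.
  case/submxP=> w ->; rewrite mulmxA.
  have : (w *m N <= N)%MS by exact: submxMl.
  move: (w *m N) => {u w} u; rewrite {1}/N [X in is_true X -> _]sub_capmx.
  case/andP=> uZ uS.
  rewrite sub_capmx submxMr /=; last first.
    by apply: submx_trans uS _; apply/cutspS/subsetP => v vS; case/andP: (subS v vS).
  rewrite eqZ // submxMr //.
  by apply: submx_trans uS _; apply/cutspS/subsetP => v vS; case/andP: (subS v vS).
rewrite sub_capmx => /andP[/submxP[p uE] /submxP[q uE']].
move: uE uE'; rewrite !mulmxA.
have : (p *m cutsp G (X :|: ~: A) <= cutsp G (X :|: ~: A))%MS by exact: submxMl.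
have : (q *m cutsp G (Y :|: ~: B) <= cutsp G (Y :|: ~: B))%MS by exact: submxMl.
move: (p *m _) (q *m _) => {p q} p q qY pX uE uE'.
(* Both preimages of u are moved into Z, modulo the cut spaces killed by [theta] and [theta']. *)
have [[z1 b1] /= pE] : exists z, p = z.1 *m Z + z.2 *m cutsp G (~: A).
  by apply/sub_addsmxP; apply: submx_trans (submx1 _) fullA.
have [[z2 b2] /= qE] : exists z, q = z.1 *m Z + z.2 *m cutsp G (~: B).
  by apply/sub_addsmxP; apply: submx_trans (submx1 _) fullB.
have z1Z : (z1 *m Z <= Z)%MS by exact: submxMl.
have z2Z : (z2 *m Z <= Z)%MS by exact: submxMl.
have b1B : (b1 *m cutsp G (~: A) <= cutsp G (~: A))%MS by exact: submxMl.
have b2B : (b2 *m cutsp G (~: B) <= cutsp G (~: B))%MS by exact: submxMl.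
move: pE qE z1Z z2Z b1B b2B; move: (z1 *m _) (b1 *m _) (z2 *m _) (b2 *m _).
move=> {z1 z2 b1 b2} z1 b1 z2 b2 pE qE z1Z z2Z b1B b2B.
have z1X : (z1 <= cutsp G (X :|: ~: A))%MS.
  rewrite -(addrK b1 z1) -pE addmx_sub // eqmx_opp.
  by apply: submx_trans b1B _; apply: cutspS; exact: subsetUr.
have z2Y : (z2 <= cutsp G (Y :|: ~: B))%MS.
  rewrite -(addrK b2 z2) -qE addmx_sub // eqmx_opp.
  by apply: submx_trans b2B _; apply: cutspS; exact: subsetUr.
have uz1 : u = z1 *m theta' by rewrite uE pE mulmxDl (kA b1) ?addr0 ?eqZ.
have uz2 : u = z2 *m theta' by rewrite uE' qE mulmxDl (kB b2) ?addr0.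
have : (z1 - z2 <= cutsp G A + cutsp G B)%MS.
  apply: kZ; last by rewrite mulmxBl -uz1 -uz2 subrr.
  by rewrite addmx_sub ?eqmx_opp.
case/sub_addsmxP=> -[a b] /= abE.
have aA : (a *m cutsp G A <= cutsp G A)%MS by exact: submxMl.
have bB : (b *m cutsp G B <= cutsp G B)%MS by exact: submxMl.
move: abE aA bB; move: (a *m _) (b *m _) => {a b} a b abE aA bB.
(* A common preimage: the form z1 - b shows that it is null on A minus X, the form z2 + a that it is
   null on B minus Y. *)
pose t := z1 - b.
have tE : t = z2 + a.
  by apply/eqP; rewrite /t subr_eq -addrA -abE addrCA subrr addr0.
have tZ : (t <= Z)%MS by rewrite addmx_sub // eqmx_opp (submx_trans bB).
have -> : u = t *m theta.
  rewrite eqZ // tE mulmxDl (kB a) ?addr0 //.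
  by apply: submx_trans aA _; exact: cutspS.
apply: submxMr; rewrite sub_capmx tZ /=; apply/cutspP => v vS.
have [vX|vX] := boolP (v \in X :|: ~: A); last first.
  apply: nullB; first by move/cutspP: z1X; apply.
  move/cutspP: bB; apply; apply: contra vX => /(subsetP BnA).
  by rewrite !inE => ->; rewrite orbT.
rewrite tE; apply: nullD.
  move/cutspP: z2Y; apply; apply: contra vS => vY.
  move: vX vY; rewrite !inE; case: (v \in X) => //=; case: (v \in Y) => //=.
  by rewrite negb_or => -> ->.
move/cutspP: aA; apply; apply: contra vS => vA; move: vX.
by rewrite !inE vA orbF => ->.
Qed.

End CutSpaces.

(** * Minors seen inside the space of the original graph *)

Section MinorSpace.
Variables (F : fieldType) (V : finType) (G G' : star_graph F V).
Variables (Phi : 'M[F]_#|V|) (U : {set V}).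
Hypothesis iso : local_iso G G' Phi.
Implicit Types (S C : {set V}) (u : 'rV[F]_#|V|).

(** The vectors of G' supported on U, carried to G by Phi. *)
Definition minor_space := vmask F U *m Phi.

Lemma minor_spaceP u :
  (u *m Phi <= minor_space)%MS <-> forall v, v \notin U -> coord u v = 0.
Proof.
have [fPhi _] := iso; rewrite submxMfree //.
exact: sub_mask.
Qed.

Lemma rank_minor_space : \rank minor_space = #|U|.
Proof. by have [fPhi _] := iso; rewrite mxrankMfree // rank_mask. Qed.

(** Read in G', a vector of Q already vanishes outside U and C, so lying in the minor space costs at
    most one equation per vertex of C. *)
Lemma rank_cap_minor_space C (Q : 'M_#|V|) :
  (Q <= cutsp G (U :|: C))%MS ->
  (\rank Q <= \rank (Q :&: minor_space) + #|C|)%N.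
Proof.
have [fPhi nPhi] := iso => QC.
have uPhi : Phi \in unitmx by rewrite -row_free_unit.
rewrite -(mxrank_mul_ker Q (invmx Phi *m vmask F C)) addnC leq_add //; last first.
  by rewrite mulmxA (leq_trans (mxrankM_maxr _ _)) // rank_mask.
apply: mxrankS; apply/rV_subP => u.
rewrite sub_capmx => /andP[uQ /sub_kermxP uC].
rewrite sub_capmx uQ /= -(mulmxKV uPhi u); apply/minor_spaceP => v vU.
have [vC|vC] := boolP (v \in C).
  have := coord_mask (u *m invmx Phi) C v; rewrite vC mulr1n => <-.
  by rewrite -mulmxA uC coord0.
apply: (@null0 _ _ G'); rewrite -nPhi mulmxKV //.
move/cutspP: (submx_trans uQ QC); apply.
by rewrite inE negb_or vU.
Qed.

(** A vector of the minor must vanish at a removed vertex, but its product with the matrix is free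
    there; hence the cut space of S together with the removed vertices. *)
Lemma rank_minor_cutsp S :
  S \subset U ->
  (rk G' S (U :\: S) + \rank (minor_space :&: cutsp G (S :|: ~: U)) = #|S|)%N.
Proof.
move=> SU; have [fPhi nPhi] := iso; rewrite -(rank_ksp G' S (U :\: S)).
congr (_ + _)%N; apply/esym/(rank_preim fPhi) => u; rewrite sub_capmx.
apply/kspP/andP=> [[uS uC]|[/minor_spaceP uU /cutspP uC]].
  split.
    by apply/minor_spaceP => v vU; apply: uS; apply: contra vU => /(subsetP SU).
  apply/cutspP => v; rewrite !inE negb_or negbK => /andP[vS vU].
  by rewrite nPhi /null uS // uC ?eqxx // inE vS.
split=> v.
  move=> vS; have [vU|/uU//] := boolP (v \in U).
  by apply: (@null0 _ _ G'); rewrite -nPhi uC // !inE negb_or negbK vS.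
rewrite inE => /andP[vS vU]; have := uC v.
by rewrite nPhi !inE negb_or negbK vS => /(_ vU)/andP[_ /eqP].
Qed.

Lemma rk_minor_le S : S \subset U -> (rk G' S (U :\: S) <= lam G S)%N.
Proof.
move=> SU; have := rank_minor_cutsp SU; have := rank_cutsp G S.
have := @rank_cap_minor_space set0 (cutsp G S).
rewrite setU0 cards0 addn0 => /(_ (cutspS _ SU)) r1.
have r2 : (\rank (cutsp G S :&: minor_space) <=
           \rank (minor_space :&: cutsp G (S :|: ~: U)))%N.
  by rewrite mxrankS // sub_capmx capmxSr (submx_trans (capmxSl _ _)) ?cutspS ?subsetUl.
have aux (a b c d q t : nat) : (a <= b -> b <= c -> d + a = q -> t + c = q ->
  t <= d)%N by lia.
exact: aux r1 r2.
Qed.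

End MinorSpace.

(** * Boundary spaces and their transport along a chain *)

Section Boundary.
Variables (F : fieldType) (V : finType) (k : nat).
Implicit Types (G : star_graph F V) (A X Y : {set V}).
Implicit Types (theta : 'M[F]_(#|V|, k)) (T : 'M[F]_k) (u : 'rV[F]_#|V|).

(** Prescribing the kernel embeds the boundary space of A, a quotient, into F^k, where the
    boundaries of different sets A can be compared. *)
Definition boundary_map G A theta := forall u : 'rV_#|V|,
  (u *m theta == 0) = (u <= cutsp G A + cutsp G (~: A))%MS.

Lemma exists_boundary_map G A :
  (lam G A + lam G (~: A) <= k)%N -> exists theta, boundary_map G A theta.
Proof.
move=> lk.
have [|theta thetaP] := @kernel_of_subspace F #|V| k (cutsp G A + cutsp G (~: A))%MS.
  rewrite rank_cutspU; last by rewrite disjoints_subset setCK.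
  have := rank_cutsp G A; have := rank_cutsp G (~: A); have := cardsC A.
  by clear -lk; lia.
by exists theta.
Qed.

Lemma boundary_map_l G A theta u :
  boundary_map G A theta -> (u <= cutsp G A)%MS -> u *m theta = 0.
Proof. by move=> bA uA; apply/eqP; rewrite bA (submx_trans uA) ?addsmxSl. Qed.

Lemma boundary_map_r G A theta u :
  boundary_map G A theta -> (u <= cutsp G (~: A))%MS -> u *m theta = 0.
Proof. by move=> bA uA; apply/eqP; rewrite bA (submx_trans uA) ?addsmxSr. Qed.

(** The case of [rank_merge] where nothing is removed: Z is the whole space and B the complement of
    A. *)
Lemma lam_merge G A theta X Y :
  boundary_map G A theta -> X \subset A -> Y \subset ~: A ->
  (lam G (X :|: Y) + \rank (xside G A theta X :&: yside G A theta Y) =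
   lam G X + lam G Y)%N.
Proof.
move=> bA XA YA; have dA : [disjoint A & ~: A] by rewrite disjoints_subset setCK.
have := @rank_merge F V k G A (~: A) 1%:M theta theta X Y dA.
rewrite !submx1 => /(_ _ isT isT) H.
have {H} := H (fun u _ => erefl).
rewrite (submx_trans (submx1 _) (addsmxSl _ _)) => /(_ isT).
rewrite setCK (submx_trans (submx1 _) (addsmxSl _ _)) => /(_ isT).
move=> /(_ (fun u => boundary_map_r bA) (fun u => boundary_map_l bA)).
have kZ (u : 'rV_#|V|) : (u <= 1%:M)%MS -> u *m theta = 0 ->
    (u <= cutsp G A + cutsp G (~: A))%MS.
  by move=> _ /eqP; rewrite bA.
move=> /(_ kZ XA YA); rewrite setUCr setCT setU0 cap1mx.
have cXY : (#|X| + #|Y| = #|X :|: Y|)%N.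
  by rewrite cardsU [X :&: Y](_ : _ = set0) ?cards0 ?subn0 //;
     apply: disjoint_setI0; exact: disjointW XA YA dA.
have := rank_cutsp G X; have := rank_cutsp G Y; have := rank_cutsp G (X :|: Y).
by clear -cXY; lia.
Qed.

Lemma rank_xside_cap G A theta X T :
  boundary_map G A theta -> X \subset A ->
  (\rank (xside G A theta X :&: T) + (\rank (cutsp G X) + \rank (cutsp G (~: A)))
   = \rank (cutsp G (X :|: ~: A) :&: kermx (theta *m cokermx T)))%N.
Proof.
move=> bA XA; rewrite -rank_image_cap; congr (_ + _)%N.
have dA : [disjoint A & ~: A] by rewrite disjoints_subset setCK.
rewrite -rank_cutspU; last exact: disjointWl XA dA.
apply/eqmx_rank/andP; split; apply/rV_subP => u.
  move=> uXA; rewrite sub_capmx; apply/andP; split.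
    apply: submx_trans uXA _; rewrite addsmx_sub.
    by rewrite !cutspS ?subsetUl ?subsetUr.
  apply/sub_kermxP/eqP; rewrite bA; apply: submx_trans uXA _.
  by rewrite addsmxS ?cutspS.
rewrite sub_capmx => /andP[uS /sub_kermxP/eqP]; rewrite bA => uA.
have := cutsp_cap dA uA uS.
rewrite setIUl [~: A :&: A]setIC setICr setU0 (setIidPl XA) => /submx_trans; apply.
by rewrite addsmxS // cutspS // subsetIr.
Qed.

(** The last two conclusions serve different ends: the first computes the cut-ranks of the minor by
    gluing, the second makes every test passed by A' be passed by A. *)
Lemma boundary_step G G' (Phi : 'M[F]_#|V|) A A' (r : nat) theta' :
  local_iso G G' Phi -> A \subset A' -> boundary_map G A' theta' ->
  rk G' A (~: A') = r -> rk G' (~: A') A = r ->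
  lam G A = r -> lam G A' = r -> lam G (~: A) = r -> lam G (~: A') = r ->
  exists theta, [/\ boundary_map G A theta,
    forall X Y, X \subset A -> Y \subset ~: A' ->
      (rk G' (X :|: Y) ((A :|: ~: A') :\: (X :|: Y)) +
       \rank (xside G A theta X :&: yside G A' theta' Y) = lam G X + lam G Y)%N
  & forall X T, X \subset A' ->
      (lam G (X :&: A) + \rank (xside G A' theta' X :&: T) <=
       lam G X + \rank (xside G A theta (X :&: A) :&: T))%N].
Proof.
move=> iso AA' bA' rA rB lA lA' lB lB'.
set B' := ~: A'; pose U := A :|: B'; pose Z := minor_space Phi U.
have dAB : [disjoint A & B'] by rewrite disjoints_subset setCK.
have A'E : A :|: ~: U = A'.
  apply/setP => v; rewrite !inE; have := subsetP AA' v.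
  by case: (v \in A) => [->|_] //=; rewrite negbK.
have BE : B' :|: ~: U = ~: A.
  apply/setP => v; rewrite !inE; have := subsetP AA' v.
  case: (v \in A) => [->|_] //=.
  by rewrite negbK orNb.
have AU : A \subset U by exact: subsetUl.
have BU : B' \subset U by exact: subsetUr.
have rcA := rank_cutsp G A; have rcA' := rank_cutsp G A'.
have rcB := rank_cutsp G (~: A); have rcB' := rank_cutsp G B'.
rewrite lA in rcA; rewrite lA' in rcA'; rewrite lB in rcB; rewrite lB' in rcB'.
have cU : #|U| = (#|A| + #|B'|)%N.
  by rewrite cardsU disjoint_setI0 // cards0 subn0.
have cA := cardsC A; have cA' := cardsC A'.
have subZ (S : {set V}) : S \subset U -> (cutsp G S <= Z)%MS.
  move=> SU; have := @rank_cap_minor_space _ _ _ _ _ U iso set0 (cutsp G S).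
  rewrite setU0 => /(_ (cutspS _ SU)); rewrite cards0 addn0 => rS.
  apply: submx_trans (capmxSr (cutsp G S) Z).
  by rewrite -(mxrank_leqif_sup (capmxSl _ _)) eqn_leq rS mxrankS ?capmxSl.
(* As A still has cut-rank r in the minor, its cut space there has the dimension of the cut space of
   A in G, which it contains. *)
have ZA' (u : 'rV_#|V|) : (u <= Z)%MS -> (u <= cutsp G A')%MS -> (u <= cutsp G A)%MS.
  have := rank_minor_cutsp iso AU; rewrite A'E.
  have -> : U :\: A = B' by rewrite setDUl setDv set0U (setDidPl _) // disjoint_sym.
  rewrite rA -/Z => rZ uZ uA'.
  have uI : (u <= Z :&: cutsp G A')%MS by rewrite sub_capmx uZ.
  apply: submx_trans uI _.
  rewrite -(mxrank_leqif_sup _); last by rewrite sub_capmx subZ ?cutspS.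
  by apply/eqP; clear -rZ rcA; lia.
have ZB (u : 'rV_#|V|) : (u <= Z)%MS -> (u <= cutsp G (~: A))%MS -> (u <= cutsp G B')%MS.
  have := rank_minor_cutsp iso BU; rewrite BE.
  have -> : U :\: B' = A by rewrite setDUl setDv setU0 (setDidPl _).
  rewrite rB -/Z => rZ uZ uA'.
  have uI : (u <= Z :&: cutsp G (~: A))%MS by rewrite sub_capmx uZ.
  apply: submx_trans uI _.
  rewrite -(mxrank_leqif_sup _); last first.
    by rewrite sub_capmx subZ // cutspS // setCS.
  by apply/eqP; clear -rZ rcB'; lia.
have rZ : \rank Z = #|U| by exact: rank_minor_space iso.
(* A dimension count: the intersection of Z with W' is at most W, so the sum is everything. *)
have full (W W' : 'M_#|V|) : (W <= W')%MS ->
    (forall u : 'rV_#|V|, (u <= Z)%MS -> (u <= W')%MS -> (u <= W)%MS) ->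
    (#|V| + \rank W <= #|U| + \rank W')%N -> (1%:M <= Z + W')%MS.
  move=> WW' cap dW.
  have /mxrankS : (Z :&: W' <= W)%MS.
    by apply/rV_subP => u; rewrite sub_capmx => /andP[]; exact: cap.
  have := mxrank_sum_cap Z W'; rewrite rZ => e1 e2.
  rewrite sub1mx /row_full eqn_leq rank_leq_col /=.
  have aux (a b c e f : nat) : (a + b = c -> b <= e -> f + e <= c -> f <= a)%N.
    by lia.
  exact: aux e1 e2 dW.
have fullA : (1%:M <= Z + cutsp G (~: A))%MS.
  apply: (full (cutsp G B')) => //; first by rewrite cutspS // setCS.
  have aux (a b nA nB n s t : nat) : (s + a = nA -> s + b = nB -> t + nA = n ->
    n + b <= t + nB + a)%N by lia.
  by rewrite cU; exact: aux rcB rcB' cA.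
have fullB : (1%:M <= Z + cutsp G A')%MS.
  apply: (full (cutsp G A)) => //; first by rewrite cutspS.
  have aux (a b nA nB n s t : nat) : (s + a = nA -> s + b = nB -> nB + t = n ->
    n + a <= nA + t + b)%N by lia.
  by rewrite cU; exact: aux rcA rcA' cA'.
(* [theta] agrees with [theta'] on the minor space and kills the cut space of the complement of A;
   by [ZB], [theta'] kills the overlap. *)
have [|theta [thZ thB]] := extend_by_zero fullA (theta := theta').
  by move=> u uZ uA; apply: (boundary_map_r bA'); exact: ZB.
have kZ (u : 'rV_#|V|) : (u <= Z)%MS -> u *m theta' = 0 ->
    (u <= cutsp G A + cutsp G B')%MS.
  move=> uZ /eqP; rewrite bA' => /sub_addsmxP[[a b] /= uE].
  have bB : (b *m cutsp G B' <= cutsp G B')%MS by exact: submxMl.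
  have aZ : (a *m cutsp G A' <= Z)%MS.
    rewrite -[a *m _](addrK (b *m cutsp G B')) -uE addmx_sub // eqmx_opp.
    exact: submx_trans bB (subZ _ BU).
  rewrite uE addmx_sub_adds //.
  by apply: ZA' => //; exact: submxMl.
have bA : boundary_map G A theta.
  move=> u; apply/eqP/idP => [|/sub_addsmxP[[a b] /= ->]].
    have /sub_addsmxP[[z b] /= ->] := submx_trans (submx1 u) fullA.
    rewrite mulmxDl [X in _ + X]thB ?submxMl // addr0 thZ ?submxMl //.
    move/kZ; rewrite submxMl => /(_ isT) zAB.
    apply: addmx_sub; last by rewrite (submx_trans (submxMl _ _)) ?addsmxSr.
    by apply: submx_trans zAB _; rewrite addsmxS // cutspS // setCS.
  rewrite mulmxDl [X in _ + X]thB ?submxMl // addr0 thZ.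
    apply: (boundary_map_l bA'); apply: submx_trans (submxMl _ _) _.
    exact: cutspS.
  by apply: submx_trans (submxMl _ _) _; exact: subZ.
exists theta; split=> // [X Y XA YB|X T XA'].
  have := @rank_merge F V k G A B' Z theta theta' X Y dAB thZ
    (subZ _ AU) (subZ _ BU) fullA.
  rewrite setCK => /(_ fullB thB (fun u => boundary_map_l bA') kZ XA YB) rM.
  have XYU : X :|: Y \subset U by rewrite setUSS.
  have := rank_minor_cutsp iso XYU; rewrite -/Z rM.
  have -> : #|X :|: Y| = (#|X| + #|Y|)%N.
    by rewrite cardsU disjoint_setI0 ?cards0 ?subn0 //; exact: disjointW XA YB dAB.
  have := rank_cutsp G X; have := rank_cutsp G Y.
  by rewrite -/U; clear; lia.
(* Both intersections with T are counted as spaces of vectors. Intersecting [Q] with Z loses at most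
   |X minus A| dimensions, and the rest, with the cut space of the complement of A, lies in the
   space counted for A. *)
have e1 := rank_xside_cap T bA' XA'.
have e2 := rank_xside_cap T bA (subsetIr X A).
set Q := (cutsp G (X :|: ~: A') :&: _)%MS in e1.
have e3 : (\rank Q <= \rank (Q :&: Z) + #|X :\: A|)%N.
  apply: (rank_cap_minor_space iso).
  apply: submx_trans (capmxSl _ _) _; apply: cutspS; apply/subsetP => v.
  by rewrite !inE; case: (v \in A); case: (v \in X); case: (v \in A').
have eQ : (\rank (Q :&: Z)%MS + \rank (cutsp G (~: A)) <=
    \rank (cutsp G (X :&: A :|: ~: A) :&: kermx (theta *m cokermx T)) + \rank (cutsp G B'))%N.
  rewrite -mxrank_sum_cap leq_add //; apply: mxrankS.
    rewrite addsmx_sub; apply/andP; split; apply/rV_subP => u.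
      rewrite [X in is_true X -> _]sub_capmx => /andP[].
      rewrite [X in is_true X -> _]sub_capmx => /andP[uX /sub_kermxP uT] uZ.
      rewrite sub_capmx; apply/andP; split.
        apply: submx_trans uX (cutspS _ _); apply/subsetP => v; rewrite !inE.
        case: (boolP (v \in A)) => [/(subsetP AA')->|]; rewrite ?orbT //.
        by rewrite !orbF andbT.
      by apply/sub_kermxP; rewrite mulmxA thZ // -mulmxA.
    move=> uA; rewrite sub_capmx (submx_trans uA) ?cutspS ?subsetUr //=.
    by apply/sub_kermxP; rewrite mulmxA thB // mul0mx.
  apply/rV_subP => u; rewrite [X in is_true X -> _]sub_capmx => /andP[].
  by rewrite [X in is_true X -> _]sub_capmx => /andP[_ uZ] uA; exact: ZB.
have cX := cardsID A X.
have e4 := rank_cutsp G X; have e5 := rank_cutsp G (X :&: A).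
have aux (x' lX m' rQ x0 l0 mm rP q c aX nX a0 n0 : nat) :
  (x' + (lX + m') = rQ -> x0 + (l0 + mm) = rP -> rQ <= q + c ->
   q + mm <= rP + m' -> aX + lX = nX -> a0 + l0 = n0 -> n0 + c = nX ->
   a0 + x' <= aX + x0)%N by lia.
exact: aux e1 e2 e3 eQ e4 e5 cX.
Qed.

End Boundary.

(** * Tests and their normal forms *)

Section Tests.
Local Open Scope nat_scope.
Variables (V : finType) (L : eqType).
Implicit Types (A X Y : {set V}) (e : L * nat) (t : seq (L * nat)).

(* A test is read from left to right while vertices of A are added one at a
   time to X: [ok e X] says that X is admissible while e is the current entry. *)
Definition decreasing_ok (ok : L * nat -> {set V} -> bool) :=
  forall T a b X, a <= b -> ok (T, b) X -> ok (T, a) X.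

Section Pass.
Variables (A : {set V}) (ok : L * nat -> {set V} -> bool).

Definition add_step e X X' :=
  [&& ok e X, ok e X' & [exists x in A, X' == x |: X]].

Definition reach e X X' := ok e X && connect (add_step e) X X'.

Fixpoint pass t X X' :=
  if t is e :: t' then [exists X1, reach e X X1 && pass t' X1 X'] else X == X'.

Lemma passP e t X X' :
  reflect (exists2 X1, reach e X X1 & pass t X1 X') (pass (e :: t) X X').
Proof. exact: (iffP exists_inP) => -[X1]; exists X1. Qed.

Lemma reach_refl e X : ok e X -> reach e X X.
Proof. by move=> okX; rewrite /reach okX connect0. Qed.

Lemma reach_trans e X1 X2 X3 : reach e X1 X2 -> reach e X2 X3 -> reach e X1 X3.
Proof. by move=> /andP[okX c12] /andP[_ c23]; rewrite /reach okX (connect_trans c12). Qed.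

Lemma reach_ind e X' (P : {set V} -> Prop) :
  (ok e X' -> P X') ->
  (forall X x, ok e X -> x \in A -> reach e (x |: X) X' -> P (x |: X) -> P X) ->
  forall X, reach e X X' -> P X.
Proof.
move=> P0 PS X /andP[okX /connectP[p]].
elim: p X okX => [|X1 p IH] X okX /= => [_ X'E|].
  by rewrite -X'E; apply: P0; rewrite X'E.
case/andP=> /and3P[_ ok1 /exists_inP[x xA /eqP X1E]] pth lE.
apply: (PS _ x) => //; rewrite -X1E; last exact: IH.
by rewrite /reach ok1; apply/connectP; exists p.
Qed.

Lemma reach_okr e X X' : reach e X X' -> ok e X'.
Proof.
case/andP=> okX /connectP[p].
elim: p X okX => [|X1 p IH] X okX /= => [_ ->//|].
by case/andP=> /and3P[_ ok1 _]; exact: IH.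
Qed.

Lemma pass_cons_trans e t X X1 X' :
  reach e X X1 -> pass (e :: t) X1 X' -> pass (e :: t) X X'.
Proof.
by move=> r1 /passP[X2 r2 p2]; apply/passP; exists X2 => //; exact: reach_trans r1 r2.
Qed.

Lemma pass_cat s t X X' :
  pass (s ++ t) X X' = [exists X1, pass s X X1 && pass t X1 X'].
Proof.
elim: s X => [|e s IH] X.
  apply/idP/exists_inP => [pt|[X1 /eqP->//]]; by exists X => //=.
rewrite cat_cons; apply/passP/exists_inP => -[X1].
  move=> r; rewrite IH => /exists_inP[X2 p2 p3]; exists X2 => //.
  by apply/passP; exists X1.
case/passP=> X2 r p2 p3; exists X2 => //; rewrite IH; apply/exists_inP.
by exists X1.
Qed.

Hypothesis ok_dec : decreasing_ok ok.

Lemma reach_le T a b X X' : a <= b -> reach (T, b) X X' -> reach (T, a) X X'.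
Proof.
move=> ab /andP[okX c]; rewrite /reach (ok_dec ab) //=.
apply: connect_sub c => Y Y' /and3P[o1 o2 ex]; apply: connect1.
by rewrite /add_step ex (ok_dec ab) // (ok_dec ab).
Qed.

Lemma pass_const T w X :
  all (fun c => ok (T, c) X) w -> pass [seq (T, c) | c <- w] X X.
Proof.
elim: w => [|c w IH] //= /andP[okc /IH pw].
by apply/existsP; exists X; rewrite reach_refl.
Qed.

Lemma pass_up T a w X X' :
  all (leq a) w -> ok (T, a) X -> pass [seq (T, c) | c <- w] X X' -> reach (T, a) X X'.
Proof.
elim: w X => [|c w IH] X /=; first by move=> _ okX /eqP<-; exact: reach_refl.
case/andP=> ac aw okX /passP[X1 /(reach_le ac) r1 p1].
exact: reach_trans r1 (IH _ aw (reach_okr r1) p1).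
Qed.

(** Steps made under entries of w can be made under the smaller a; conversely w is passed without
    moving at a set admissible for b. *)
Lemma pass_squeeze_up T a b w X X' :
  all (fun c => a <= c <= b) w ->
  pass [seq (T, c) | c <- a :: rcons w b] X X' = pass [:: (T, a); (T, b)] X X'.
Proof.
move=> wab; rewrite map_cons map_rcons; apply/passP/passP => -[X1 r1].
  rewrite -cats1 pass_cat => /exists_inP[X2 p2 p3]; exists X2 => //.
  apply: (reach_trans r1); apply: pass_up (reach_okr r1) p2.
  by apply: sub_all wab => c /andP[].
move=> p1; exists X1 => //; rewrite -cats1 pass_cat; apply/exists_inP; exists X1 => //.
apply: pass_const; apply: sub_all wab => c /andP[_ cb]; apply: ok_dec cb _.
by case/passP: p1 => X2 /andP[].
Qed.

Lemma pass_squeeze_down T a b w X X' :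
  all (fun c => b <= c <= a) w ->
  pass [seq (T, c) | c <- a :: rcons w b] X X' = pass [:: (T, a); (T, b)] X X'.
Proof.
move=> wab; rewrite map_cons map_rcons; apply/passP/passP => -[X1 r1].
  rewrite -cats1 pass_cat => /exists_inP[X2 p2 p3]; exists X1 => //.
  case/passP: p3 => X3 r3 /eqP <-; apply/passP; exists X3; last exact/eqP.
  case: w wab p2 => [|c w] wab p2; first by move/eqP: p2 => ->.
  apply: reach_trans r3; apply: pass_up p2.
    by apply: sub_all wab => d /andP[].
  case/andP: wab => /andP[bc ca] _.
  exact: ok_dec (leq_trans bc ca) (reach_okr r1).
move=> p1; exists X1 => //; rewrite -cats1 pass_cat; apply/exists_inP; exists X1 => //.
apply: pass_const; apply: sub_all wab => c /andP[_ ca]; apply: ok_dec ca _.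
exact: reach_okr r1.
Qed.

End Pass.

(** Quantified over A and [ok], so that one normal form serves both A and A' with their boundary
    maps. *)
Definition equiv_test t t' := forall A ok, decreasing_ok ok ->
  forall X X', pass A ok t X X' = pass A ok t' X X'.

Lemma equiv_refl t : equiv_test t t.
Proof. by []. Qed.

Lemma equiv_cat s s' t t' :
  equiv_test s s' -> equiv_test t t' -> equiv_test (s ++ t) (s' ++ t').
Proof.
move=> es et A ok okd X X'; rewrite !pass_cat; apply: eq_existsb => X1.
by rewrite (es A ok okd) (et A ok okd).
Qed.

Lemma split_first (T : eqType) (P : pred T) (w : seq T) :
  has P w -> exists w1 x w2, [/\ w = w1 ++ x :: w2, P x & all (predC P) w1].
Proof.
elim: w => [|x w IH] //; have [Px _|nPx] := boolP (P x).
  by exists [::], x, w.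
rewrite /= (negPf nPx) => /= hw; have [w1 [y [w2 [-> Py w1P]]]] := IH hw.
by exists (x :: w1), y, w2; rewrite /= nPx.
Qed.

Lemma split_last (T : eqType) (P : pred T) (w : seq T) :
  has P w -> exists w1 x w2, [/\ w = w1 ++ x :: w2, P x & all (predC P) w2].
Proof.
rewrite -has_rev => /split_first[w1 [x [w2 [wE Px w1P]]]].
exists (rev w2), x, (rev w1); rewrite all_rev; split=> //.
by rewrite -[w]revK wE rev_cat rev_cons cat_rcons.
Qed.

(* Between the first and the last occurrence of the maximum, only the maximum
   and the minimum matter. *)
Lemma normal_form_const T M (w : seq nat) :
  all (fun c => c < M) w ->
  exists w', [/\ all (fun c => c < M) w', size w' + 3 <= 3 * 2 ^ M &
    equiv_test [seq (T, c) | c <- w] [seq (T, c) | c <- w']].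
Proof.
(* The summand 3 closes the induction: two words of size at most 3 * 2 ^ M - 3 with at most 3
   letters between them have total size at most 3 * 2 ^ M.+1 - 3. *)
elim: M w => [|M IH] w wM.
  by exists [::]; case: w wM => //=; split=> //; exact: equiv_refl.
have weak w' : all (fun c => c < M) w' -> all (fun c => c < M.+1) w'.
  by apply: sub_all => c /ltnW.
have strict w' : all (predC (pred1 M)) w' -> all (fun c => c < M.+1) w' ->
    all (fun c => c < M) w'.
  move=> /allP n1 /allP n2; apply/allP => c cw; have := n1 c cw; have := n2 c cw.
  by rewrite /= ltnS leq_eqVlt => /orP[->|].
have [Mw|Mw] := boolP (has (pred1 M) w); last first.
  have [|w' [a b c]] := IH w; first by apply: strict => //; rewrite all_predC.
  by exists w'; split=> //; [exact: weak | rewrite expnS; clear -b; lia].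
have [w1 [x [w2 [wE /eqP xM w1P]]]] := split_first Mw.
rewrite {x}xM in wE; move: wM; rewrite wE all_cat /= => /and3P[w1M _ w2M].
have [w1' [a1 b1 c1]] := IH w1 (strict _ w1P w1M).
have [Mw2|Mw2] := boolP (has (pred1 M) w2); last first.
  have [|w2' [a2 b2 c2]] := IH w2; first by apply: strict => //; rewrite all_predC.
  exists (w1' ++ M :: w2'); rewrite all_cat /= !weak // ltnSn; split=> //.
    by rewrite size_cat /= expnS; clear -b1 b2; lia.
  rewrite !map_cat; apply: equiv_cat => //=.
  exact: (equiv_cat (equiv_refl [:: (T, M)])).
have [w3 [x [w4 [w2E /eqP xM w4P]]]] := split_last Mw2.
rewrite {x}xM in w2E; move: w2M; rewrite w2E all_cat /= => /and3P[w3M _ w4M].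
have [w4' [a4 b4 c4]] := IH w4 (strict _ w4P w4M).
have [u [uM us uE]] : exists u, [/\ all (fun c => c < M.+1) u, size u <= 3 &
    equiv_test [seq (T, c) | c <- M :: rcons w3 M] [seq (T, c) | c <- u]].
  case: w3 w3M {w2E} => [|c w3] w3M.
    by exists [:: M; M]; rewrite /= !ltnSn; split=> //; exact: equiv_refl.
  have c_in : c \in c :: w3 by exact: mem_head.
  pose m := \big[minn/c]_(d <- c :: w3) d.
  have mle d : d \in c :: w3 -> m <= d.
    move=> dw; rewrite /m; move: (c :: w3) dw {c_in w3M} => l.
    elim: l => [|y l IHl] //; rewrite big_cons inE => /orP[/eqP->|/IHl].
      exact: geq_minl.
    exact: leq_trans (geq_minr _ _).
  have min : m \in c :: w3.
    rewrite /m; have : {subset c :: w3 <= c :: w3} by [].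
    move: {1 3}(c :: w3) => l; elim: l => [|y l IHl] ls; first by rewrite big_nil.
    rewrite big_cons /minn; case: ifP => _; first by apply: ls; exact: mem_head.
    by apply: IHl => z zl; apply: ls; rewrite inE zl orbT.
  have [l1 [l2 lE]] : exists l1 l2, c :: w3 = l1 ++ m :: l2.
    by case/splitPr: min => l1 l2; exists l1, l2.
  have lM : all (fun d => m <= d <= M) (l1 ++ m :: l2).
    apply/allP => d; rewrite -lE => dl; rewrite mle //=.
    by have /allP/(_ d dl) := w3M; rewrite ltnS.
  have mM : m <= M.
    by move/allP: lM => /(_ m); rewrite mem_cat mem_head orbT leqnn => /(_ isT).
  move: lM; rewrite all_cat /= => /and3P[l1M _ l2M].
  exists [:: M; m; M]; split=> // [|A ok okd X X'].
    by rewrite /= !ltnS mM leqnn.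
  rewrite -[LHS]/(pass A ok [seq (T, d) | d <- M :: rcons (c :: w3) M] X X').
  have -> : [seq (T, d) | d <- M :: rcons (c :: w3) M] =
      [seq (T, d) | d <- M :: rcons l1 m] ++ [seq (T, d) | d <- rcons l2 M].
    by rewrite -map_cat lE /= rcons_cat cat_rcons.
  have E1 : equiv_test [seq (T, d) | d <- M :: rcons l1 m] [:: (T, M); (T, m)].
    by move=> A' ok' okd' Y Y'; exact: pass_squeeze_down.
  have E2 : equiv_test ((T, m) :: [seq (T, d) | d <- rcons l2 M]) [:: (T, m); (T, M)].
    by move=> A' ok' okd' Y Y'; exact: (pass_squeeze_up A' okd').
  rewrite (equiv_cat E1 (equiv_refl _) A okd) /=.
  by have := equiv_cat (equiv_refl [:: (T, M)]) E2 A okd X X'.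
exists (w1' ++ u ++ w4'); rewrite !all_cat uM !weak //; split=> //.
  by rewrite !size_cat expnS; clear -b1 b4 us; lia.
rewrite !map_cat; apply: equiv_cat => //.
have -> : M :: w3 ++ M :: w4 = (M :: rcons w3 M) ++ w4 by rewrite /= cat_rcons.
by rewrite map_cat; apply: equiv_cat.
Qed.

Variable d : L -> nat.

(** In the application the labels are growing subspaces and [d] is the dimension, so an unchanged
    dimension means the same subspace. *)
Definition chain_rel e e' := (d e.1 < d e'.1) || (e.1 == e'.1).

Lemma chain_rel_trans : transitive chain_rel.
Proof.
move=> e2 e1 e3; rewrite /chain_rel.
case/orP=> [l1|/eqP->//] /orP[l2|/eqP<-]; rewrite ?(ltn_trans l1 l2) // l1 //.
Qed.

(** The entries with the largest value of [d] form a suffix with a single label, to which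
    [normal_form_const] applies; the rest is handled by induction on D. *)
Lemma normal_form D M t :
  sorted chain_rel t -> all (fun e => d e.1 < D) t -> all (fun e => e.2 < M) t ->
  exists t', [/\ all (fun e => e.2 < M) t', size t' <= D * (3 * 2 ^ M) &
    equiv_test t t'].
Proof.
elim: D t => [|D IH] t st tD tM.
  by exists [::]; case: t tD {st tM} => //=; split=> //; exact: equiv_refl.
have [hD|nD] := boolP (has (fun e => d e.1 == D) t); last first.
  have [//|//|t' [a b c]] := IH t st.
    apply/allP => e et; have /allP/(_ e et) := tD; rewrite ltnS leq_eqVlt.
    by case/orP=> // eD; case/negP: nD; apply/hasP; exists e.
  by exists t'; split=> //; apply: leq_trans b _; rewrite leq_mul2r leqnSn orbT.
have [t1 [[T c] [t2 [tE /eqP TD t1P]]]] := split_first hD.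
move: st tD tM; rewrite {t hD}tE => st.
rewrite !all_cat => /andP[t1D t2D] /andP[t1M t2M].
have [st1 st2] : sorted chain_rel t1 /\ sorted chain_rel ((T, c) :: t2).
  by move: st; rewrite !(sorted_pairwise chain_rel_trans) pairwise_cat => /and3P[].
have [//|//|t1' [a b c1]] := IH t1 st1.
  apply/allP => e et; have /allP/(_ e et) := t1D; have /allP/(_ e et) := t1P.
  by rewrite /= ltnS leq_eqVlt => /negPf->.
have t2T e : e \in (T, c) :: t2 -> e.1 = T.
  rewrite inE => /orP[/eqP->//|et].
  have /allP/(_ e et) := order_path_min chain_rel_trans st2.
  have /allP/(_ e) := t2D; rewrite inE et orbT => /(_ isT).
  by rewrite /chain_rel TD /= ltnS leqNgt => /negPf-> /eqP.
have t2E : (T, c) :: t2 = [seq (T, c) | c <- map snd ((T, c) :: t2)].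
  rewrite -map_comp -[LHS]map_id; apply/eq_in_map => -[T' c'] /t2T /= -> //.
have [|w [aw bw cw]] := @normal_form_const T M (map snd ((T, c) :: t2)).
  by rewrite all_map.
exists (t1' ++ [seq (T, c) | c <- w]); split.
- by rewrite all_cat a all_map.
- by rewrite size_cat size_map mulSn addnC leq_add // (leq_trans (leq_addr 3 _)).
by rewrite t2E; apply: equiv_cat.
Qed.

End Tests.

(** * Vertex sequences and the tests they give *)

Section Sequences.
Local Open Scope nat_scope.
Variables (V : finType) (p : nat).
Implicit Types (A B X Y S U : {set V}) (f : {set V} -> nat) (s : seq V).

Fixpoint good f S s :=
  (f S <= p) && (if s is x :: s' then good f (x |: S) s' else true).

Lemma setU_nil S : S :|: [set x in [::]] = S.
Proof. by apply/setP => y; rewrite !inE orbF. Qed.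

Lemma goodP f S s :
  reflect (forall i, i <= size s -> f (S :|: [set x in take i s]) <= p)
          (good f S s).
Proof.
elim: s S => [|x s IH] S /=.
  rewrite andbT; apply: (iffP idP) => [fS [|i] // _|/(_ 0 isT)]; by rewrite setU_nil.
have E i : S :|: [set y in take i.+1 (x :: s)] = x |: S :|: [set y in take i s].
  by apply/setP => y; rewrite !inE orbCA orbA.
apply: (iffP andP) => [[fS /IH gS] [|i] si|fS].
- by rewrite setU_nil.
- by rewrite E gS.
split; last by apply/IH => i si; rewrite -E; exact: fS.
by have := fS 0 isT; rewrite setU_nil.
Qed.

Variables (L : eqType) (e : {set V} -> L * nat) (ok : L * nat -> {set V} -> bool).

Fixpoint tests_of Y s :=
  e Y :: (if s is y :: s' then tests_of (y |: Y) s' else [::]).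

Section Interleaving.
Variables (A B : {set V}) (f : {set V} -> nat).
Hypothesis dAB : [disjoint A & B].
Hypothesis okE :
  forall X Y, X \subset A -> Y \subset B -> ok (e Y) X = (f (X :|: Y) <= p).

(** Reading s, a vertex of B moves to the next entry of the test and a vertex of A enlarges X under
    the current entry. *)
Lemma pass_of_good X Y s :
  X \subset A -> Y \subset B -> {subset s <= A :|: B} ->
  A \subset X :|: [set x in s] -> good f (X :|: Y) s ->
  pass A ok (tests_of Y [seq x <- s | x \in B]) X A.
Proof.
elim: s X Y => [|x s IH] X Y XA YB sAB AX /=.
  rewrite andbT => fXY; apply/exists_inP; exists X; last first.
    rewrite /= eqEsubset XA; apply: subset_trans AX _.
    by apply/subsetP => z; rewrite !inE orbF.
  by apply: reach_refl; rewrite okE.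
case/andP=> fXY gs; have okX : ok (e Y) X by rewrite okE.
have sAB' : {subset s <= A :|: B} by move=> z zs; apply: sAB; rewrite inE zs orbT.
case: ifP => xB.
  apply/passP; exists X; first exact: reach_refl.
  apply: IH => //.
  - by rewrite subUset sub1set xB.
  - apply/subsetP => z zA; have := subsetP AX z zA; rewrite !inE.
    case: eqVneq => // zx; move: xB; rewrite -zx => zB.
    by have := disjointFr dAB zA; rewrite zB.
  by rewrite setUCA.
have xA : x \in A by have := sAB x (mem_head _ _); rewrite inE xB orbF.
have XA' : x |: X \subset A by rewrite subUset sub1set xA.
have p1 : pass A ok (tests_of Y [seq x <- s | x \in B]) (x |: X) A.
  apply: IH => //; last by rewrite -setUA.
  by apply: subset_trans AX _; apply/subsetP => z; rewrite !inE orbCA orbA.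
have r1 : reach A ok (e Y) X (x |: X).
  rewrite /reach okX connect1 // /add_step okX okE //=; apply/andP; split.
    by rewrite -setUA; case: (s) gs => [|? ?] /= /andP[].
  by apply/exists_inP; exists x.
have [t tE] : exists t, tests_of Y [seq x <- s | x \in B] = e Y :: t.
  by case: [seq _ <- _ | _] => [|y s'] /=; eexists.
by move: p1; rewrite tE; exact: pass_cons_trans r1.
Qed.

Lemma good_of_reach X Y X1 (P : pred V) :
  Y \subset B -> reach A ok (e Y) X X1 -> X \subset A -> {subset P <= B} ->
  (X1 \subset A -> exists s, [/\ good f (X1 :|: Y) s, uniq s
     & s =i [predU A :\: X1 & P]]) ->
  exists s, [/\ good f (X :|: Y) s, uniq s & s =i [predU A :\: X & P]].
Proof.
move=> YB r XA PB base; move: X r XA; apply: reach_ind => // X x okX xA _ IH XA.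
have XA' : x |: X \subset A by rewrite subUset sub1set xA.
(* A step of [reach] may add a vertex already present; it is dropped, so that the sequence has no
   repetition. *)
have [xX|xX] := boolP (x \in X).
  by move: IH; rewrite (setUidPr _) ?sub1set //; apply.
have [s [gs us sE]] := IH XA'; exists (x :: s); split=> [/=||z].
- by rewrite -okE // okX setUA.
- rewrite /= us andbT sE !inE eqxx /=; apply/negP => /PB xB.
  by have := disjointFr dAB xA; rewrite xB.
rewrite in_cons sE !inE; have [->|] := eqVneq z x; last by [].
by rewrite xX xA.
Qed.

(** The converse interleaving: the vertices of A added under an entry are inserted before the next
    vertex of s. *)
Lemma good_of_pass X Y s :
  X \subset A -> Y \subset B -> {subset s <= B} -> uniq s ->
  pass A ok (tests_of Y s) X A ->
  exists s', [/\ good f (X :|: Y) s', uniq s' & s' =i [predU A :\: X & s]].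
Proof.
elim: s X Y => [|y s IH] X Y XA YB sB us /passP[X1 r p1].
  move/eqP: p1 => X1A; rewrite {X1}X1A in r.
  apply: (good_of_reach YB r) => // _; exists [::]; split=> [||z] //=.
    by rewrite andbT -okE // (reach_okr r).
  by rewrite !inE andNb.
have yB : y \in B by apply: sB; exact: mem_head.
have sB' : {subset s <= B} by move=> z zs; apply: sB; rewrite inE zs orbT.
apply: (good_of_reach YB r) => // X1A.
case/andP: us => ys us.
have [|s' [gs us' sE]] := IH X1 (y |: Y) X1A _ sB' us p1.
  by rewrite subUset sub1set yB.
exists (y :: s'); split=> [/=||z].
- by rewrite -okE // (reach_okr r) setUCA.
- rewrite /= us' andbT sE !inE (negPf ys) orbF negb_and negbK.
  by rewrite (disjointFl dAB yB) orbT.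
by rewrite in_cons sE !inE orbCA.
Qed.

End Interleaving.

(** Intersect all sets of a passing chain with A; a step adding a vertex outside A becomes
    stationary. *)
Lemma pass_restrict A A' (ok' : L * nat -> {set V} -> bool) t X X' :
  (forall c (Z : {set V}), Z \subset A' -> ok' c Z -> ok c (Z :&: A)) ->
  A \subset A' -> X \subset A' ->
  pass A' ok' t X X' -> pass A ok t (X :&: A) (X' :&: A).
Proof.
move=> okS AA'; elim: t X => [|c t IH] X XA' /=; first by move/eqP->.
case/passP=> X1 r p1; apply/passP.
suff [X1A' r'] : X1 \subset A' /\ reach A ok c (X :&: A) (X1 :&: A).
  by exists (X1 :&: A) => //; exact: IH.
move: X r XA' {p1}; apply: reach_ind => [okX1 X1A'|X x okX xA' _ IHr XA'].
  by split=> //; apply: reach_refl; exact: okS.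
have [|X1A' r] := IHr; first by rewrite subUset sub1set xA'.
split=> //; have [xA|xA] := boolP (x \in A).
  have E : (x |: X) :&: A = x |: (X :&: A).
    by apply/setP => z; rewrite !inE; case: eqVneq => // ->; rewrite xA.
  apply: (reach_trans _ r); rewrite E; have okX2 := okS _ _ XA' okX.
  rewrite /reach okX2 connect1 //; apply/and3P; split=> //.
    by rewrite -E; have /andP[] := r.
  by apply/exists_inP; exists x.
suff <- : (x |: X) :&: A = X :&: A by [].
apply/setP => z; rewrite !inE; case: eqVneq => // ->.
by rewrite (negPf xA) !andbF.
Qed.

Lemma pass_ok A t X X' c : pass A ok t X X' -> c \in t -> exists Z, ok c Z.
Proof.
elim: t X => [|c' t IH] X //= /passP[X1 r p1]; rewrite inE => /orP[/eqP->|ct].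
  by exists X1; exact: reach_okr r.
exact: IH p1 ct.
Qed.

End Sequences.

(** * Linked chains and layouts *)

Section LinkedChain.
Local Open Scope nat_scope.
Variables (V : finType) (f : {set V} -> nat) (m : nat).

(** [w] bounds the number of values. With N the bound for one value less, there is room for N.+1
    blocks of m.+1 sets, and one set from each block makes a chain of length N. *)
Fixpoint chain_bound w :=
  if w is w'.+1 then m.+1 * (chain_bound w').+1 else 0.

Lemma chain_bound_le w : (chain_bound w).+1 <= m.+2 ^ w.
Proof.
elim: w => //= w IH; rewrite expnS; have : 0 < m.+2 ^ w by rewrite expn_gt0.
have : m.+1 * (chain_bound w).+1 <= m.+1 * m.+2 ^ w by rewrite leq_mul.
by move: (m.+2 ^ w) => x; clear; nia.
Qed.

Definition strict_chain (S : nat -> {set V}) n :=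
  forall i, i < n -> S i \proper S i.+1.

Lemma strict_chainS S n i j : strict_chain S n -> i <= j <= n -> S i \subset S j.
Proof.
move=> Sn /andP[ij jn]; rewrite -(subnKC ij).
have : i + (j - i) <= n by rewrite subnKC.
elim: (j - i) => [|l IH]; first by rewrite addn0.
rewrite addnS => il; apply: subset_trans (IH (ltnW il)) _.
exact/proper_sub/Sn.
Qed.

(* Either a block of m.+1 consecutive sets has no set of smaller value in
   between, or each block provides such a set, and these form a chain of
   smaller value. *)
Lemma linked_chain w S n :
  strict_chain S n -> (forall i, i <= n -> f (S i) < w) -> chain_bound w <= n ->
  exists r T, [/\ r < w, strict_chain T m, forall i, i <= m -> f (T i) = r
    & forall X : {set V}, T 0 \subset X -> X \subset T m -> r <= f X].
Proof.
elim: w S n => [|w IH] S n Sn fS nB; first by have := fS 0 isT.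
pose N := chain_bound w.
have Nn q i : q <= N -> i <= m -> q * m.+1 + i <= n.
  move=> qN im; apply: leq_trans nB => /=; rewrite -/N.
  by clear -qN im; nia.
have [/existsP[q /forallP qP]|] := boolP [exists q : 'I_N.+1, [forall X : {set V},
    (S (q * m.+1) \subset X) && (X \subset S (q * m.+1 + m)) ==> (w <= f X)]].
  have qN : q <= N by rewrite -ltnS.
  exists w, (fun i => S (q * m.+1 + i)); split=> // [i im|i im|X].
  - by rewrite addnS; apply: Sn; rewrite -addnS Nn.
  - apply/eqP; rewrite eqn_leq -ltnS fS ?Nn //=.
    have /implyP := qP (S (q * m.+1 + i)); apply.
    rewrite !(@strict_chainS _ n) ?Nn ?leq_addr ?leq_add2l ?andbT //.
  by rewrite addn0 => S0 Sm; have /implyP := qP X; apply; rewrite S0.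
rewrite negb_exists => /forallP noq.
pose P q (X : {set V}) :=
  [&& S (q * m.+1) \subset X, X \subset S (q * m.+1 + m) & f X < w].
have PX q : q <= N -> exists X, P q X.
  rewrite -ltnS => qN; have := noq (Ordinal qN).
  rewrite negb_forall => /existsP[X]; rewrite negb_imply -ltnNge /= -andbA.
  by exists X.
pose T q := odflt set0 [pick X | P q X].
have TP q : q <= N -> P q (T q).
  move=> /PX[X PqX]; rewrite /T; case: pickP => //= noX.
  by rewrite noX in PqX.
have [||//|r [T' [rw T'P T'r T'X]]] := IH T N; last first.
- by exists r, T'; split=> //; exact: ltnW.
- by move=> q /TP/and3P[].
(* The last set of a block is strictly inside the first set of the next, which separates the chosen
   sets. *)
move=> q qN.
have /and3P[_ T1 _] := TP q (ltnW qN); have /and3P[T2 _ _] := TP q.+1 qN.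
apply: sub_proper_trans T1 (proper_sub_trans _ T2).
rewrite mulSn addSn addnC; apply: Sn.
by rewrite -ltnS -addnS; have := Nn q.+1 0 qN isT; rewrite mulSn; clear; lia.
Qed.

End LinkedChain.

(** * Layouts as vertex sequences *)

Section Layouts.
Local Open Scope nat_scope.
Variables (F : fieldType) (V : finType) (p : nat).
Implicit Types (G : star_graph F V) (U S : {set V}) (s : seq V).

Lemma lrw_good G s :
  uniq s -> (forall x, x \in s) -> good p (lam G) set0 s -> lrw G <= p.
Proof.
move=> us sV /goodP gs; apply/lrw_leP.
have size_s : size s = #|V|.
  by rewrite -(card_uniqP us); apply: eq_card => x; rewrite sV.
have lt x : index x s < #|V| by rewrite -size_s index_mem.
exists [ffun x => Ordinal (lt x)]; split.
  apply: inj_card_bij; last by rewrite card_ord.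
  move=> x y; rewrite !ffunE => /(congr1 val) /= xy.
  by rewrite -(nth_index x (sV x)) xy nth_index.
rewrite /layout_width; apply/bigmax_leqP_seq => i; rewrite mem_index_iota => /andP[_ iV] _.
rewrite cutrk_rk; have := gs i; rewrite size_s set0U => /(_ (ltnW iV)).
suff -> : [set x | [ffun x => Ordinal (lt x)] x < i] = [set x in take i s] by [].
by apply/setP => x; rewrite !inE ffunE /= in_take.
Qed.

Lemma induced_lrw_good G U :
  lrw (induced G U) <= p ->
  exists s, [/\ uniq s, s =i U & good p (fun S => rk G S (U :\: S)) set0 s].
Proof.
case/lrw_leP => pi [[pi' piK pi'K] width].
pose W := {x : V | x \in U}.
pose h (i : 'I_#|{: W}|) := val (pi' i).
have h_inj : injective h by move=> i j /val_inj/(can_inj pi'K).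
have hpi w : h (pi w) = val w by rewrite /h piK.
pose s := [seq h i | i <- enum 'I_#|{: W}|].
have us : uniq s by rewrite map_inj_uniq ?enum_uniq.
have sU : s =i U.
  move=> x; apply/mapP/idP => [[i _ ->]|xU]; first exact: (valP (pi' i)).
  by exists (pi (exist _ x xU)); rewrite ?mem_enum // hpi.
have size_s : size s = #|{: W}| by rewrite size_map size_enum_ord.
exists s; split=> //; apply/goodP => i; rewrite size_s set0U => iW.
have takeE : [set x in take i s] = val @: [set w : W | pi w < i].
  have idx w : index (val w) s = pi w.
    by rewrite -hpi index_map // index_enum_ord.
  apply/setP => x; rewrite !inE; apply/idP/imsetP => [xs|[w]].
    have xU : x \in U by rewrite -sU (mem_take xs).
    exists (exist _ x xU) => //; rewrite inE.
    by move: xs; rewrite in_take ?sU // (idx (exist _ x xU)).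
  by rewrite inE => wi ->; rewrite in_take ?idx // sU (valP w).
(* The width of a layout ignores the empty and the full initial set; there the rank is 0. *)
case: i iW takeE => [|i]; first by rewrite take0 [[set x in _]](_ : _ = set0) ?rk_empty_l //;
  apply/setP => x; rewrite !inE.
rewrite leq_eqVlt => /orP[/eqP iW _|iW takeE].
  rewrite take_oversize ?size_s ?iW //.
  rewrite [X in rk _ _ X](_ : _ = set0) ?rk_empty //.
  by apply/setP => x; rewrite !inE sU andNb.
rewrite takeE -cutrk_induced; apply: (leq_trans _ width).
rewrite /layout_width.
by apply: (@leq_bigmax_seq _ _ xpredT
    (fun i => cutrk (induced G U) [set x | pi x < i]));
  rewrite ?mem_index_iota.
Qed.

End Layouts.

(** * Obstructions *)

Section Characteristics.
Local Open Scope nat_scope.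
Variables (F : finFieldType) (V : finType) (G : star_graph F V) (p k : nat).
Implicit Types (A X Y : {set V}) (theta : 'M[F]_(#|V|, k)).

(** By [lam_merge], for the entry of a set Y this says that X and Y together have cut-rank at most
    p. *)
Definition char_ok A theta (c : 'M[F]_k * nat) X :=
  lam G X + c.2 <= p + \rank (xside G A theta X :&: c.1)%MS.

(** The canonical generator [<<_>>] makes equal subspaces equal labels. *)
Definition char_at A theta Y : 'M[F]_k * nat :=
  (<<yside G A theta Y>>%MS, lam G Y).

Lemma char_ok_decreasing A theta : decreasing_ok (char_ok A theta).
Proof. by move=> T a b X ab /=; apply: leq_trans; rewrite leq_add2l. Qed.

Lemma char_atE A theta A' theta' X Y :
  char_ok A theta (char_at A' theta' Y) X =
  (lam G X + lam G Y <= p + \rank (xside G A theta X :&: yside G A' theta' Y)%MS).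
Proof. by rewrite /char_ok /= (cap_eqmx (eqmx_refl _) (genmxE _)). Qed.

Lemma char_ok_lam A theta X Y :
  boundary_map G A theta -> X \subset A -> Y \subset ~: A ->
  char_ok A theta (char_at A theta Y) X = (lam G (X :|: Y) <= p).
Proof.
by move=> bA XA YA; rewrite char_atE -(lam_merge bA XA YA) leq_add2r.
Qed.

(** The side of Y grows with Y, and growth without change of dimension is equality. *)
Lemma char_sorted A theta Y s :
  sorted (chain_rel (fun T : 'M[F]_k => \rank T))
    (tests_of (char_at A theta) Y s).
Proof.
suff: forall Y0, Y0 \subset Y ->
    path (chain_rel (fun T : 'M[F]_k => \rank T)) (char_at A theta Y0)
      (tests_of (char_at A theta) Y s).
  by move=> /(_ Y (subxx _)); case: s => [|y s] /= => /andP[].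
elim: s Y => [|y s IH] Y Y0 Y0Y; rewrite [tests_of _ _ _]/=;
  rewrite [path _ _ _]/=; apply/andP; split=> //; last first.
- by apply: IH; exact: subsetUr.
all: have sY : (yside G A theta Y0 <= yside G A theta Y)%MS
  by rewrite submxMr // cutspS // setSU.
all: rewrite /chain_rel /= !genmxE ltn_neqAle mxrankS // andbT -implyNb negbK.
all: by apply/implyP; rewrite (mxrank_leqif_sup sY) => Ys;
  apply/eqP/genmxP; rewrite sY.
Qed.

Variable l : nat.
(** An admissible entry has number at most p + k, since a subspace of F^k has dimension at most
    k. *)
Let M := (p + k).+1.

(** [None] is padding, so tuples of length l encode all tests of length at most l. *)
Definition decode (t : l.-tuple (option ('M[F]_k * 'I_M))) :=
  [seq (e.1, val e.2) | e <- pmap id t].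

Lemma decode_surj (t : seq ('M[F]_k * nat)) :
  all (fun e => e.2 < M) t -> size t <= l -> exists t', decode t' = t.
Proof.
move=> tM tl; pose s := [seq Some (e.1, inord e.2 : 'I_M) | e <- t].
have size_s : size (s ++ nseq (l - size t) None) == l.
  by rewrite size_cat size_map size_nseq subnKC.
exists (Tuple size_s); rewrite /decode /= pmap_cat map_cat.
have -> : pmap id (nseq (l - size t) (None : option ('M[F]_k * 'I_M))) = [::].
  by elim: (l - size t).
rewrite cats0 /s; elim: t tM {tl s size_s} => //= -[T c] t IH /andP[cM tM].
by rewrite IH //= inordK.
Qed.

Definition passed A theta : {set l.-tuple (option ('M[F]_k * 'I_M))} :=
  [set t | pass A (char_ok A theta) (decode t) set0 A].

End Characteristics.

(** * Strict growth of the set of passed tests *)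

Section Obstruction.
Local Open Scope nat_scope.
Variables (F : finFieldType) (sigma : F -> F) (V : finType).
Variables (G : star_graph F V) (p k : nat).
Hypothesis sesqui : sesqui_morphism sigma.
Hypothesis obs : pivot_minor_obstruction sigma p G.
Implicit Types (A X Y U : {set V}) (theta : 'M[F]_(#|V|, k)).

Lemma obstruction_minor G' U :
  pivot_equivalent sigma G G' -> U \proper setT -> lrw (induced G' U) <= p.
Proof.
move=> eqG UT; have [_ _] := obs; apply; split.
  exists G'; split=> //; exists U; exists id; split=> //.
  by exists id.
have -> : #|{: {x : V | x \in U}}| = #|U|.
  by rewrite card_sig; apply: eq_card => x; rewrite inE.
by rewrite -cardsT proper_card.
Qed.

(** The bound of [normal_form] for k.+1 possible dimensions and numbers below (p + k).+1. *)
Let l := k.+1 * (3 * 2 ^ (p + k).+1).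

Lemma passed_step A A' r theta' :
  A \proper A' -> lam G A = r -> lam G A' = r ->
  (forall X, A \subset X -> X \subset A' -> r <= lam G X) ->
  boundary_map G A' theta' ->
  exists2 theta, boundary_map G A theta &
    passed G p l A' theta' \proper passed G p l A theta.
Proof.
move=> pAA' lA lA' link bA'; have AA' := proper_sub pAA'.
have [symG ltG minG] := obs.
have lamC X : lam G (~: X) = lam G X.
  by rewrite /lam setCK (rk_sym sesqui).
pose C := A' :\: A.
have CE : ~: C = A :|: ~: A'.
  by apply/setP => v; rewrite !inE negb_and negbK.
have [||| G' [Phi [eqG sym' iso L]]] :=
  linking sesqui (A := A) (B := ~: A') (r := r) (C := C) symG.
- apply/linkedP => S AS SA'; rewrite setTD; apply: link => //.
  by apply: subset_trans SA' _; apply/subsetP => v; rewrite !inE negbK andbT.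
- by rewrite disjoint_sym disjoints_subset; apply/subsetP => v; rewrite !inE => ->.
- by rewrite disjoints_subset setCK subsetDl.
have UA : (A :|: ~: A') :\: A = ~: A'.
  rewrite setDUl setDv set0U; apply/setDidPl.
  by rewrite disjoint_sym disjoints_subset setCK.
have AU : A \subset ~: C by rewrite CE subsetUl.
have rA : rk G' A (~: A') = r.
  apply/eqP; rewrite eqn_leq; apply/andP; split; last first.
    have /linkedP/(_ A (subxx _)) := L; rewrite CE UA; apply.
    rewrite setDE setCK; apply/subsetP => v vA.
    by rewrite !inE vA (subsetP AA').
  by have := rk_minor_le iso AU; rewrite CE UA lA.
have rB : rk G' (~: A') A = r by rewrite (rk_sym sesqui).
have [|| theta [bA merge mono]] := boundary_step iso AA' bA' rA rB lA lA'.
- by rewrite lamC.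
- by rewrite lamC.
exists theta => //.
(* The minor on the complement of C is proper because A differs from A', so it has a layout of width
   at most p. *)
have [s [us sU gs]] : exists s, [/\ uniq s, s =i ~: C
    & good p (fun S => rk G' S (~: C :\: S)) set0 s].
  apply: induced_lrw_good; apply: obstruction_minor => //.
  rewrite properEneq subsetT andbT; apply/negP => /eqP CT.
  case/properP: pAA' => _ [x xA' xA]; have := in_setT x.
  by rewrite -CT !inE xA xA'.
pose B := ~: A'.
have dAB : [disjoint A & B] by rewrite disjoints_subset setCK.
have dAB' : [disjoint A' & B] by rewrite disjoints_subset setCK.
have okH X Y : X \subset A -> Y \subset B ->
    char_ok G p A theta (char_at G A' theta' Y) X =
    (rk G' (X :|: Y) (~: C :\: (X :|: Y)) <= p).
  by move=> XA YB; rewrite char_atE -(merge _ _ XA YB) leq_add2r CE.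
pose t := tests_of (char_at G A' theta') set0 [seq x <- s | x \in B].
have pt : pass A (char_ok G p A theta) t set0 A.
  apply: (pass_of_good (f := fun S => rk G' S (~: C :\: S)) dAB okH);
    rewrite ?sub0set ?setU0 //.
    by move=> x; rewrite sU CE.
  by apply/subsetP => x xA; rewrite !inE sU CE inE xA.
have [||| t' [t'M t'l tt']] :=
  @normal_form V _ (fun T : 'M[F]_k => \rank T) k.+1 (p + k).+1 t.
- exact: char_sorted.
- by apply/allP => e _; rewrite ltnS rank_leq_col.
- apply/allP => e et; have [Z] := pass_ok pt et; rewrite ltnS => eZ.
  apply: leq_trans (leq_addl _ _) (leq_trans eZ _).
  by rewrite leq_add2l rank_leq_col.
have [t'' t''E] := decode_surj (l := l) t'M t'l.
(* Inclusion comes from the monotonicity given by [boundary_step]; the separating test is the normal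
   form of the test of that layout. *)
apply/properP; split.
  apply/subsetP => q; rewrite !inE => pq.
  have mono' (c : 'M[F]_k * nat) (Z : {set V}) : Z \subset A' ->
      char_ok G p A' theta' c Z -> char_ok G p A theta c (Z :&: A).
    move=> ZA'; have := mono Z c.1 ZA'; rewrite /char_ok.
    have aux (a b x y m n : nat) : a + x <= b + y -> b + m <= n + x ->
      a + m <= n + y by clear; lia.
    exact: aux.
  have := pass_restrict mono' AA' (sub0set _) pq.
  by rewrite set0I (setIidPr AA').
exists t''; rewrite inE t''E -?tt' //; try exact: char_ok_decreasing.
(* If A' passed this test, interleaving A' with the vertices of B would give a layout of G of width
   at most p. *)
apply/negP => pt'; move: ltG; rewrite ltnNge => /negP; apply.
have [||||s' [gs' us' s'E]] := good_of_pass (f := lam G) (X := set0) (Y := set0) dAB'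
    (fun X Y => @char_ok_lam _ _ G p k A' theta' X Y bA') _ _ _ _ pt'.
- by rewrite sub0set.
- by rewrite sub0set.
- by move=> x; rewrite mem_filter => /andP[].
- by rewrite filter_uniq.
apply: (lrw_good us') => [x|]; last by rewrite setU0 in gs'.
rewrite s'E !inE mem_filter sU CE !inE.
by case: (x \in A'); rewrite /= ?orbT.
Qed.
End Obstruction.

(** * Size of an obstruction *)

Section ObstructionSize.
Local Open Scope nat_scope.
Variables (F : finFieldType) (sigma : F -> F) (V : finType).
Variables (G : star_graph F V) (p : nat).
Hypothesis sesqui : sesqui_morphism sigma.
Hypothesis obs : pivot_minor_obstruction sigma p G.

(** Room for boundaries of dimension 2r with r at most p.+1. *)
Let k := p.+1 + p.+1.
Let l := k.+1 * (3 * 2 ^ (p + k).+1).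

(** Going down from T m to T 0, each step transfers the boundary map and strictly enlarges the set
    of passed tests. *)
Lemma linked_chain_length m r (T : nat -> {set V}) :
  r <= p.+1 -> strict_chain T m -> (forall i, i <= m -> lam G (T i) = r) ->
  (forall X : {set V}, T 0 \subset X -> X \subset T m -> r <= lam G X) ->
  m <= #|{: l.-tuple (option ('M[F]_k * 'I_(p + k).+1))}|.
Proof.
move=> rp Tm Tr link; have [symG _ _] := obs.
have lamC X : lam G (~: X) = lam G X by rewrite /lam setCK (rk_sym sesqui).
suff: forall j, j <= m -> exists2 theta : 'M_(#|V|, k),
    boundary_map G (T (m - j)) theta &
    j <= #|passed G p l (T (m - j)) theta|.
  move=> /(_ m (leqnn _)) [theta _ /leq_trans]; apply; exact: max_card.
elim=> [_|j IH jm].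
  have [|theta th] := @exists_boundary_map F V k G (T m); last first.
    by exists theta; rewrite ?subn0.
  by rewrite lamC !Tr // leq_add.
have [theta' b' c'] := IH (ltnW jm).
have mj : m - j = (m - j.+1).+1 by rewrite subnS prednK // subn_gt0.
rewrite mj in b' c'; have jlt : m - j.+1 < m by rewrite -mj leq_subr.
have [|theta b pr] := passed_step sesqui obs (Tm _ jlt) (Tr _ (ltnW jlt)) (Tr _ jlt) _ b'.
  move=> X TX XT; apply: link.
    by apply: subset_trans TX; apply: (strict_chainS Tm); rewrite leq0n ltnW.
  by apply: subset_trans XT _; apply: (strict_chainS Tm); rewrite jlt leqnn.
by exists theta => //; apply: leq_ltn_trans c' (proper_card pr).
Qed.

(** Deleting a vertex x0 leaves a layout of width at most p; adding x0 to every initial set raises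
    each cut-rank by at most 1. *)
Lemma obstruction_chain : 0 < #|V| ->
  exists2 S, strict_chain S #|V|.-1 & forall i, i <= #|V|.-1 -> lam G (S i) <= p.+1.
Proof.
case/card_gt0P=> x0 _; pose U := ~: [set x0].
have [s [us sU /goodP gs]] : exists s, [/\ uniq s, s =i U
    & good p (fun S => rk G S (U :\: S)) set0 s].
  apply: induced_lrw_good; apply: (obstruction_minor obs).
    exact: pivot_equivalent_refl.
  rewrite properEneq subsetT andbT; apply/negP => /eqP UT.
  by have := in_setT x0; rewrite -UT !inE eqxx.
have size_s : size s = #|V|.-1.
  rewrite -(card_uniqP us) -subn1 -(cards1 x0) -cardsT -cardsDS ?subsetT //.
  by apply: eq_card => x; rewrite sU !inE andbT.
have x0s : x0 \notin s by rewrite sU !inE eqxx.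
exists (fun i => x0 |: [set x in take i s]) => [i iV|i].
  have is_ : i < size s by rewrite size_s.
  apply/properP; split.
    apply/setUS/subsetP => x; rewrite !inE (take_nth x0) // mem_rcons inE => ->.
    by rewrite orbT.
  exists (nth x0 s i); first by rewrite !inE (take_nth x0) // mem_rcons mem_head orbT.
  rewrite !inE negb_or; apply/andP; split.
    by apply: contraNneq x0s => <-; rewrite mem_nth.
  by rewrite in_take ?mem_nth // index_uniq // ltnn.
rewrite -size_s => /gs; rewrite set0U => gi.
apply: leq_trans (rk_addv _ _ _ _) _; rewrite ltnS; apply: leq_trans gi.
by rewrite /U setDE -setCU.
Qed.

Lemma obstruction_size :
  #|V| <= #|{: l.-tuple (option ('M[F]_k * 'I_(p + k).+1))}|.+3 ^ p.+2.
Proof.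
have [->//|V0] := posnP #|V|.
have [S Sn Sp] := obstruction_chain V0.
pose t := #|{: l.-tuple (option ('M[F]_k * 'I_(p + k).+1))}|.
rewrite -/t leqNgt; apply/negP => tV.
(* The cut-ranks take the p.+2 values from 0 to p.+1, and [t.+1] exceeds the number of tests. *)
have [||r [T [rp Tm Tr link]]] := linked_chain (f := lam G) (m := t.+1) (w := p.+2) Sn.
- by move=> i /Sp; rewrite ltnS.
- rewrite -ltnS (prednK V0); apply: leq_trans (ltnW tV); exact: chain_bound_le.
by have := linked_chain_length rp Tm Tr link; rewrite -/t ltnn.
Qed.

End ObstructionSize.

(** * Numerical estimate *)

Lemma obstruction_bound (c p : nat) (k := (p.+1 + p.+1)%N)
    (l := (k.+1 * (3 * 2 ^ (p + k).+1))%N) :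
  (1 < c)%N -> (0 < p)%N ->
  (((c ^ (k * k) * (p + k).+1).+1 ^ l).+3 ^ p.+2 <= c ^ (c ^ (20 * p)))%N.
Proof.
move=> c1 p0; have c0 : (0 < c)%N by exact: ltnW.
have lt_c n : (n < c ^ n)%N by exact: ltn_expl.
have lt_2 n : (n < 2 ^ n)%N by exact: ltn_expl.
set M := (p + k).+1.
have b1 : ((c ^ (k * k) * M).+1 <= c ^ (k * k + M + 1))%N.
  rewrite !expnD expn1; apply: (@leq_trans (c ^ (k * k) * c ^ M * 2)).
    have := lt_c M; have : (0 < c ^ (k * k))%N by rewrite expn_gt0 c0.
    move: (c ^ (k * k))%N (c ^ M)%N => x y x0 My.
    by clear -x0 My; nia.
  by rewrite leq_mul2l c1 orbT.
have b2 : (((c ^ (k * k) * M).+1 ^ l).+3 <= c ^ ((k * k + M + 1) * l + 2))%N.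
  apply: (@leq_trans (c ^ ((k * k + M + 1) * l)).+3).
    by rewrite !ltnS [leqRHS]expnM leq_exp2r // /l muln_gt0 /= muln_gt0 expn_gt0.
  rewrite expnD; have : (4 <= c ^ 2)%N by rewrite -[4%N]/(2 ^ 2)%N leq_exp2r.
  have : (0 < c ^ ((k * k + M + 1) * l))%N by rewrite expn_gt0 c0.
  move: (c ^ ((k * k + M + 1) * l))%N (c ^ 2)%N => x y x0 y4.
  by clear -x0 y4; nia.
apply: (@leq_trans (c ^ (((k * k + M + 1) * l + 2) * p.+2))).
  by rewrite [leqRHS]expnM leq_exp2r.
rewrite leq_exp2l //; apply: (@leq_trans (2 ^ (20 * p))); last first.
  by rewrite leq_exp2r // muln_gt0 p0.
have p1 : (p.+1 <= 2 ^ p)%N by exact: lt_2.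
have q2 : (2 <= 2 ^ p)%N by rewrite -{1}[2%N]expn1 leq_exp2l.
have kE : (p + k).+1 = (3 * p + 3)%N by rewrite /k; clear; lia.
have lE : l = ((2 * p + 3) * (3 * (2 ^ p * 2 ^ p * 2 ^ p * 8)))%N.
  by rewrite /l kE expnD mulnC [(3 * p)%N]mulnC expnM !expnS !expn0;
     clear; rewrite /k; lia.
rewrite [(20 * p)%N]mulnC expnM /M kE lE /k {lt_2 lt_c}.
(* With q = 2 ^ p, all factors polynomial in p are absorbed by powers of q, using p < q and 2 <=
   q. *)
move: (2 ^ p)%N p1 q2 => q p1 q2.
have e1 : (p.+1 + p.+1 <= q ^ 2)%N by rewrite -mulnn; clear -p1 q2; nia.
have e2 : (3 * p + 3 + 1 <= q ^ 3)%N by rewrite !expnS expn0 muln1; clear -p1 q2; nia.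
have e3 : (2 * p + 3 <= q ^ 3)%N by rewrite !expnS expn0 muln1; clear -p1 q2; nia.
have e4 : (3 <= q ^ 2)%N by rewrite -mulnn; clear -q2; nia.
have e5 : (8 <= q ^ 3)%N by rewrite -[8%N]/(2 ^ 3)%N leq_exp2r.
have e6 : (p.+2 <= q ^ 2)%N by rewrite -mulnn; clear -p1 q2; nia.
have double n x y : (x <= q ^ n -> y <= q ^ n -> x + y <= q ^ n.+1)%N.
  by move=> xn yn; rewrite expnS; clear -xn yn q2; nia.
have prod a b x y : (x <= q ^ a -> y <= q ^ b -> x * y <= q ^ (a + b))%N.
  by move=> xa yb; rewrite expnD leq_mul.
have weak a b x : (a <= b -> x <= q ^ a -> x <= q ^ b)%N.
  by move=> ab /leq_trans; apply; rewrite leq_exp2l.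
(* Exponents of q: 5 for k * k + M + 1, 11 for l, 1 for the summand 2, and 2 for p.+2; the total 19
   is rounded up to 20. *)
apply: (weak 19) => //; apply: (prod 17 2) => //; apply: (double 16).
  apply: (prod 5 11).
    rewrite -addnA; apply: (double 4); first exact: (prod 2 2).
    exact: weak e2.
  apply: (prod 3 8) => //; apply: (prod 2 6) => //; apply: (prod 3 3) => //.
  by rewrite !expnS expn0 muln1 mulnA.
by apply: (weak 2) => //; exact: ltnW.
Qed.
Local Close Scope ring_scope.
Theorem mainTheorem1 :
  exists C : nat, 0 < C /\
  forall (p : nat) (F : finFieldType) (sigma : F -> F)
    (V : finType) (G : star_graph F V),
    0 < p ->
    sesqui_morphism sigma ->
    pivot_minor_obstruction sigma p G ->
    #|V| <= #|F| ^ (#|F| ^ (C * p)).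
Proof.
exists 20%N; split=> // p F sigma V G p0 sesqui obs.
apply: leq_trans (obstruction_size sesqui obs) _.
rewrite card_tuple card_option card_prod card_mx card_ord.
by apply: obstruction_bound => //; exact: card_finNzRing_gt1.
Qed.
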